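(* Let $r\in\mathbb N$ and let $g\in C[0,\infty)$ and $f_\pm\in C[0,\infty)$ satisfy Assumptions 1 and 2 listed in the context. For $n\in\mathbb Z_+$ put $J_n:=[0,\infty)$ if $n$ is odd and $J_n:=(0,\infty]$ if $n$ is even. Then there are functions $\tau_n:J_n\to(0,\infty)$, $n\in\mathbb Z_+$, such that: 1. For every $n\in\mathbb Z_+$ and every $\alpha\in J_n$, with $\tau=\tau_n(\alpha)$, there exists a perfect $g$-spline $G=G(n,\alpha)\in\Gamma^r_{n,g}[0,\infty)$ with exactly $n$ knots that has $n+1$ positively oriented points of oscillation between $-\tau f_-$ and $\tau f_+$ and such that $$\frac{\tau f_+(\infty)-G(\infty)}{\tau f_-(\infty)+G(\infty)}=\alpha,$$ where for $\alpha=\infty$ this equality is understood as $G(\infty)=-\tau f_-(\infty)$. 2. For every $n\in\mathbb Z_+$ the function $\tau_n$ is continuous; it is non-decreasing if $n$ is odd and non-increasing if $n$ is even. 3. For all $n\in\mathbb N$ and $\alpha,\beta>0$ one has $\tau_n(\alpha)\le\tau_{n-1}(\beta)$.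
   Context: Notation: $f(\infty):=\lim_{t\to+\infty}f(t)$; $\mathbb Z_+=\{0,1,2,\ldots\}$; $(0,\infty]$ carries the usual topology of the extended half-line. Auxiliary functions: $g_0:=g$ and $g_k(t):=\int_0^t g_{k-1}(s)\,ds$, $t\ge0$, $k=1,\ldots,r$. Put $A_0:=\int_0^\infty g(t)\,dt$ and, for $k=1,\ldots,r-1$, $$A_k:=\int_0^\infty\Big[\sum_{s=0}^{k-1}\frac{(-1)^{k-s-1}A_s}{(k-s-1)!}t^{k-s-1}+(-1)^kg_k(t)\Big]dt .$$ Assumption 1: $g\in C[0,\infty)$ is positive, non-increasing, and $A_k<\infty$ for $k=0,1,\ldots,r-1$. Assumption 2: $f_+,f_-\in C[0,\infty)$ are non-increasing, positive, and $f_\pm(\infty)>0$. Perfect $g$-splines: $G\in C^{r-1}[0,\infty)$ is a perfect $g$-spline of order $r$ with $n\in\mathbb N$ knots $0<t_1<\ldots<t_n<\infty$ if, with $t_0:=0$, $t_{n+1}:=\infty$, there is $\epsilon\in\{1,-1\}$ such that for each $i=0,\ldots,n$ the derivative $G^{(r)}$ exists on $(t_i,t_{i+1})$ and $G^{(r)}(t)=\epsilon(-1)^ig(t)$ there. An $r$-th order primitive of $g$ or of $-g$ is a perfect $g$-spline of order $r$ with $0$ knots. $\Gamma^r_{n,g}[0,\infty)$ is the set of all perfect $g$-splines of order $r$ on $[0,\infty)$ with at most $n$ knots. Oscillation: for continuous $\varphi<\Phi$ on $[0,\infty)$, a continuous $x$ has $n$ positively oriented points of oscillation between $\varphi$ and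 $\Phi$ if $\varphi(t)\le x(t)\le\Phi(t)$ for all $t$ and there are points $s_1<\ldots<s_n$ in $[0,\infty)$ with $x(s_k)=\Phi(s_k)$ for odd $k$ and $x(s_k)=\varphi(s_k)$ for even $k$. *)

(* Defs.v *)
(* MathComp-Analysis development, over an arbitrary R : realType. *)
From HB Require Import structures.
From mathcomp Require Import all_boot all_order all_algebra.
From mathcomp Require Import all_classical all_reals all_analysis.

Set Implicit Arguments.
Unset Strict Implicit.
Unset Printing Implicit Defensive.

Import Order.TTheory GRing.Theory Num.Theory.
Import numFieldNormedType.Exports.

Local Open Scope classical_set_scope.
Local Open Scope ring_scope.

(* Functions on the half-line [0, oo[ are represented by total functions
   R -> R whose values at negative arguments are irrelevant: every notion
   below only inspects the function on [0, oo[. *)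

Definition cont_halfline (R : realType) (f : R -> R) : Prop :=
  {within `[0%R, +oo[, continuous f}.

Definition pos_halfline (R : realType) (f : R -> R) : Prop :=
  forall t : R, 0 <= t -> 0 < f t.

Definition noninc_halfline (R : realType) (f : R -> R) : Prop :=
  forall s t : R, 0 <= s -> s <= t -> f t <= f s.

Definition lim_infty (R : realType) (f : R -> R) : R :=
  lim (f t @[t --> +oo]).

Fixpoint iter_int (R : realType) (g : R -> R) (k : nat) : R -> R :=
  if k is k'.+1 then
    fun t => (\int[lebesgue_measure]_(s in `[0%R, t]) iter_int g k' s)%R
  else g.

(* The integrand of A_k, given the list s = [:: A_0; ...; A_(k-1)]; for k = 0
   the sum is empty and the integrand is g. It is only meaningful when the
   earlier A_s are finite, so that [fine] is just the coercion to R. *)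
Definition A_integrand (R : realType) (g : R -> R) (s : seq (\bar R))
    (k : nat) (t : R) : R :=
  \sum_(i < k) (-1) ^+ (k - i - 1) * fine (nth 0%E s i)
                 / ((k - i - 1)`!)%:R * t ^+ (k - i - 1)
  + (-1) ^+ k * iter_int g k t.

Fixpoint A_list (R : realType) (g : R -> R) (k : nat) : seq (\bar R) :=
  if k is k'.+1 then
    rcons (A_list g k')
      (\int[lebesgue_measure]_(t in `[0%R, +oo[)
         (A_integrand g (A_list g k') k' t)%:E)%E
  else [::].

Definition A_ (R : realType) (g : R -> R) (k : nat) : \bar R :=
  nth 0%E (A_list g k.+1) k.

Lemma size_A_list (R : realType) (g : R -> R) (k : nat) :
  size (A_list g k) = k.
Proof. by elim: k => //= k IH; rewrite size_rcons IH. Qed.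

Lemma nth_A_list (R : realType) (g : R -> R) (k i : nat) :
  (i < k)%N -> nth 0%E (A_list g k) i = A_ g i.
Proof.
elim: k => // k IH; rewrite ltnS leq_eqVlt => /orP[/eqP -> //|ik].
by rewrite /= nth_rcons size_A_list ik IH.
Qed.

(* The recursion actually satisfied by the A_k. *)
Lemma A_E (R : realType) (g : R -> R) (k : nat) :
  A_ g k =
  (\int[lebesgue_measure]_(t in `[0%R, +oo[)
     (\sum_(i < k) (-1) ^+ (k - i - 1) * fine (A_ g i)
                     / ((k - i - 1)`!)%:R * t ^+ (k - i - 1)
      + (-1) ^+ k * iter_int g k t)%R%:E)%E.
Proof.
rewrite {1}/A_ /= nth_rcons size_A_list ltnn eqxx.
apply: eq_integral => t _; congr (_%:E); rewrite /A_integrand; congr (_ + _).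
by apply: eq_bigr => i _; rewrite nth_A_list.
Qed.

Lemma A_0E (R : realType) (g : R -> R) :
  A_ g 0 = (\int[lebesgue_measure]_(t in `[0%R, +oo[) (g t)%:E)%E.
Proof.
rewrite A_E; apply: eq_integral => t _.
by rewrite big_ord0 add0r expr0 mul1r.
Qed.

Definition assumption1 (R : realType) (r : nat) (g : R -> R) : Prop :=
  [/\ cont_halfline g, pos_halfline g, noninc_halfline g &
      forall k : nat, (k < r)%N -> (A_ g k < +oo)%E].

Definition assumption2 (R : realType) (f : R -> R) : Prop :=
  [/\ cont_halfline f, noninc_halfline f, pos_halfline f & 0 < lim_infty f].

(* Derivative relative to [0, oo[: one-sided at t = 0, ordinary for t > 0. *)
Definition deriv_halfline (R : realType) (f : R -> R) (t l : R) : Prop :=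
  (f s - f t) / (s - t) @[s --> within [set s | 0 <= s] t^'] --> l.

(* f is in C^k[0, oo[. *)
Fixpoint Ck_halfline (R : realType) (k : nat) (f : R -> R) : Prop :=
  if k is k'.+1 then
    exists2 f' : R -> R,
      forall t : R, 0 <= t -> deriv_halfline f t (f' t) & Ck_halfline k' f'
  else cont_halfline f.

(* Perfect g-splines of order r with exactly n knots t_1 < ... < t_n; the
   strict chain 0 = t_0 < t_1 < ... < t_n < t_(n+1) = +oo in \bar R makes the
   knots finite and positive. Only points of ]0, oo[ lie in the open intervals,
   so the ordinary (two-sided) iterated derivative of G is the right one there. *)
Definition perfect_spline (R : realType) (r : nat) (g : R -> R) (n : nat)
    (G : R -> R) : Prop :=
  Ck_halfline r.-1 G /\
  exists (t_ : nat -> \bar R) (eps : R),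
    [/\ t_ 0%N = 0%E, t_ n.+1 = +oo%E,
        forall i : nat, (i <= n)%N -> (t_ i < t_ i.+1)%E,
        eps = 1 \/ eps = -1 &
        forall (i : nat) (t : R), (i <= n)%N ->
          (t_ i < t%:E)%E -> (t%:E < t_ i.+1)%E ->
          is_derive t 1 (derive1n r.-1 G) (eps * (-1) ^+ i * g t)].

Definition Gamma (R : realType) (r n : nat) (g : R -> R) : set (R -> R) :=
  [set G | exists2 m : nat, (m <= n)%N & perfect_spline r g m G].

Definition pos_oscillation (R : realType) (n : nat) (phi Phi x : R -> R)
    : Prop :=
  (forall t : R, 0 <= t -> phi t <= x t <= Phi t) /\
  exists s : nat -> R,
    [/\ forall k : nat, (1 <= k <= n)%N -> 0 <= s k,
        forall k : nat, (1 <= k < n)%N -> s k < s k.+1 &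
        forall k : nat, (1 <= k <= n)%N ->
          x (s k) = if odd k then Phi (s k) else phi (s k)].

Definition J (R : realType) (n : nat) : set (\bar R) :=
  [set a | if odd n then (0 <= a < +oo)%E else (0 < a)%E].

(* The equation (tau f_+(oo) - l) / (tau f_-(oo) + l) = a, for l = G(oo).
   For finite a the denominator is required to be nonzero, since division by
   zero yields 0 in MathComp. *)
Definition endpoint_ratio (R : realType) (fp fm : R -> R) (tau l : R)
    (a : \bar R) : Prop :=
  match a with
  | c%:E => tau * lim_infty fm + l != 0 /\
            (tau * lim_infty fp - l) / (tau * lim_infty fm + l) = c
  | +oo%E => l = - (tau * lim_infty fm)
  | -oo%E => False
  end.

(* Main.v *)
Require Import Defs.
From HB Require Import structures.
From mathcomp Require Import all_boot all_order all_algebra.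
From mathcomp Require Import all_classical all_reals all_analysis.
From mathcomp Require Import measurable_realfun ring lra.
Import Order.TTheory GRing.Theory Num.Theory.
Import numFieldNormedType.Exports.
Local Open Scope classical_set_scope.
Local Open Scope ring_scope.
Set Implicit Arguments.
Unset Strict Implicit.
Unset Printing Implicit Defensive.

(* Idea. Let [I f t] be the integral of [f] over [[t, +oo[]. Assumption 1 says exactly that
   [I] can be iterated [r] times on [g], and the splines in question are, up to an additive
   constant, [I^r (sigma g)] with [sigma] a sign changing at the knots. Sign alternations of
   [c + I^r f] propagate to [f], so the difference of two splines alternates no more often
   than their knots permit: this yields the comparison of [tau_n] with [tau_(n-1)], and that,
   for fixed [n], [tau] decreases and [v * tau] increases in the distance [v] (in units of
   [tau]) from [G(oo)] to the boundary touched last, whence monotonicity and continuity.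
   For existence, [sigma] is smoothed to [squash (M * prod_j (x_j - squash u))]. Among the
   smoothed splines on a compact interval, one that maximises the amplitude of alternation
   stays in the tube: otherwise an exchange of points leaves a point with slack, and since
   interpolation at the other [n] points by the derivatives in the [n] knots is solvable
   (Rolle), the amplitude could be increased. Then [M] and the interval tend to infinity. *)

(** [I f] tends to 0 at infinity, so no sign alternation is lost in passing from [I f] to [f]: the
    last one is recovered between the last point and infinity. An added constant costs exactly one
    alternation. Both counts are needed, for splines compared with their limits at infinity and
    without them. A knot [u] is stored as [u / (1 + |u|)], so that knots range over the compact
    [[0, 1]]. The value 1 stands for a knot at infinity, that is, for no knot; that all knots are
    finite, positive and distinct is recovered afterwards by counting alternations. Smoothing makes
    the spline differentiable in its knots, and a combination of the derivatives is a positive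
    function times a polynomial of degree below [n] in [squash u], so that [n] zeros force it to
    vanish. The oscillation points could still escape to infinity. The last one has height at least
    [tau * v] while the spline tends to 0 there, so [v > 0] keeps it bounded; the end of the range
    missing from [J n] is exactly [v = 0]. *)

(** * Integrals over [[t, +oo[] as functions of the left endpoint *)

Section TailIntegral.
Context {R : realType}.
Notation mu := (@lebesgue_measure R).
Implicit Types f k : R -> R.

Definition tail_integrable f := forall t : R, mu.-integrable `[t, +oo[ (EFin \o f).

Definition tail f (t : R) : R := \int[mu]_(s in `[t, +oo[) f s.

Lemma tail_split f a b : tail_integrable f -> a <= b ->
  tail f a = \int[mu]_(s in `[a, b]) f s + tail f b.
Proof.
move=> intf ab; have intb : mu.-integrable `]b, +oo[ (EFin \o f).
  by apply: integrableS (intf b) => //; apply: subset_itvr; rewrite bnd_simp.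
rewrite /tail -[X in _ + X]Rintegral_itv_obnd_cbnd//.
rewrite -(@Rintegral_itvB R f (BLeft a) +oo%O b) ?bnd_simp//.
by rewrite addrC subrK.
Qed.

Lemma tail_integrable_itv f a b : tail_integrable f ->
  mu.-integrable `[a, b] (EFin \o f).
Proof.
by move=> intf; apply: integrableS (intf a) => //; exact: subset_itvl.
Qed.

Lemma tail_integrableZ (c : R) f : tail_integrable f ->
  tail_integrable (fun x => c * f x).
Proof.
move=> intf t.
exact: (@integrableZl _ _ _ mu _ _ c (EFin \o f)).
Qed.

Lemma tailB f k t : tail_integrable f -> tail_integrable k ->
  tail (fun x => f x - k x) t = tail f t - tail k t.
Proof. by move=> intf intk; exact: RintegralB. Qed.

Lemma tailZ (c : R) f t : tail_integrable f ->
  tail (fun x => c * f x) t = c * tail f t.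
Proof. by move=> intf; exact: RintegralZl. Qed.

Lemma tail_integrable_le f k (c : R) : measurable_fun setT f ->
  (forall x, `|f x| <= c * k x) -> tail_integrable k -> tail_integrable f.
Proof.
move=> mf fk intk t.
apply: (le_integrable _ _ _ (tail_integrableZ c intk t)) => //.
  by apply/measurable_EFinP; exact: measurable_funTS.
move=> x _ /=; rewrite lee_fin (le_trans (fk x))//; exact: ler_norm.
Qed.

Lemma tail_diff_gt0_itv f a b : tail_integrable f -> a <= b -> tail f b < tail f a ->
  exists2 z, a <= z <= b & 0 < f z.
Proof.
move=> intf ab; rewrite (tail_split intf ab) => H.
apply: contrapT => /forall2NP nz.
have : \int[mu]_(s in `[a, b]) f s <= \int[mu]_(s in `[a, b]) 0.
  apply: le_Rintegral => //.
  - exact: tail_integrable_itv.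
  - exact: integrable0.
  - move=> x /=; rewrite in_itv/= => axb.
    by have [//|/negP] := nz x; rewrite -leNgt.
rewrite Rintegral_cst// mul0r => H'.
by move: H; rewrite ltrDr ltNge H'.
Qed.

Lemma tail_gt0_ex f a : tail_integrable f -> 0 < tail f a ->
  exists2 z, a <= z & 0 < f z.
Proof.
move=> intf H; apply: contrapT => /forall2NP nz.
have : tail f a <= \int[mu]_(s in `[a, +oo[) 0.
  apply: le_Rintegral => //.
  - exact: integrable0.
  - move=> x /=; rewrite in_itv/= andbT => ax.
    by have [//|/negP] := nz x; rewrite -leNgt.
by rewrite Rintegral_cst// mul0r leNgt H.
Qed.

(** Transfers continuity and Lipschitz bounds from the tail of the majorant [k] to the tail of [f],
    where [f] itself may jump. *)
Lemma tail_diff_norm f k (c : R) a b : tail_integrable f -> tail_integrable k ->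
  (forall x, a <= x -> `|f x| <= c * k x) -> a <= b ->
  `|tail f a - tail f b| <= c * (tail k a - tail k b).
Proof.
move=> intf intk fk ab.
rewrite (tail_split intf ab) (tail_split intk ab) !addrK.
rewrite -RintegralZl//; last exact: tail_integrable_itv.
apply: (le_trans (le_normr_Rintegral _ _)) => //.
  exact: tail_integrable_itv.
apply: le_Rintegral => //.
- exact/integrable_norm/tail_integrable_itv.
- exact: (@tail_integrable_itv _ a b (tail_integrableZ c intk)).
- by move=> x /=; rewrite in_itv/= => /andP[ax _]; exact: fk.
Qed.

Lemma tail_norm f k (c : R) a : tail_integrable f -> tail_integrable k ->
  (forall x, a <= x -> `|f x| <= c * k x) -> `|tail f a| <= c * tail k a.
Proof.
move=> intf intk fk.
rewrite -tailZ//; apply: (le_trans (le_normr_Rintegral _ _)) => //.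
apply: le_Rintegral => //.
- exact/integrable_norm.
- exact: (tail_integrableZ c intk a).
- by move=> x /=; rewrite in_itv/= andbT => ax; exact: fk.
Qed.

Lemma is_derive_tail f t : tail_integrable f -> {for t, continuous f} ->
  is_derive t 1 (tail f) (- f t).
Proof.
move=> intf cf.
have [||||dF F'] := @continuous_FTC1 R f (BLeft (t - 1)) t (t + 1).
- by rewrite ltrDl.
- exact: tail_integrable_itv.
- by rewrite (@lte_fin R) gtrBl.
- exact: cf.
set F := (X in derivable X t 1) in dF F'.
have dG : is_derive t 1 (fun x => tail f (t - 1) - F x) (- f t).
  have dF' : is_derive t 1 F (f t).
    by apply: DeriveDef; [exact: dF|rewrite -F' derive1E].
  have := is_deriveB (is_derive_cst (tail f (t - 1)) t (1 : R)) dF'.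
  by rewrite sub0r.
apply: (near_eq_is_derive _ dG).
near=> x; rewrite /F.
have tx : t - 1 <= x.
  by apply: ltW; near: x; apply: lt_nbhsr; rewrite gtrBl.
by rewrite (tail_split intf tx) addrAC subrr add0r.
Unshelve. all: by end_near. Qed.

(** Convergence is asked only almost everywhere because smoothed signs need not converge to the
    sharp sign at the knots. *)
Lemma tail_dominated_ae (f_ : nat -> R -> R) f k (t : R) : tail_integrable k ->
  (forall n, measurable_fun `[t, +oo[ (f_ n)) -> measurable_fun `[t, +oo[ f ->
  (forall n x, t <= x -> `|f_ n x| <= k x) ->
  {ae mu, forall x, t <= x -> f_ n x @[n --> \oo] --> f x} ->
  tail (f_ n) t @[n --> \oo] --> tail f t.
Proof.
move=> intk mf_ mf fk ff.
have [|||||intf _ cvg] := @dominated_convergence _ _ _ mu `[t, +oo[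
  (measurable_itv _) (fun n x => (f_ n x)%:E) (EFin \o f) (EFin \o k).
- by move=> n; apply: measurableT_comp (mf_ n).
- exact/measurable_EFinP.
- apply: (@filterS _ _ (ae_filter_ringOfSetsType mu) _ _ _ ff) => x.
  rewrite /= in_itv/= andbT => + tx => /(_ tx) H.
  by apply: cvg_EFin => //; exact: nearW.
- exact: intk.
- apply: aeW => x n; rewrite /= in_itv/= andbT => tx.
  by rewrite lee_fin; exact: fk.
have fnum : (\int[mu]_(x in `[t, +oo[) (EFin \o f) x)%E \is a fin_num.
  exact: integrable_fin_num.
rewrite /tail /Rintegral; apply: fine_cvg; rewrite fineK//; exact: cvg.
Unshelve. all: by end_near. Qed.

Lemma tail_cvg_at_oo f : tail_integrable f -> tail f t @[t --> +oo] --> (0 : R).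
Proof.
move=> intf; pose k : R -> R := fun x => `|f x|.
have intk : tail_integrable k by move=> t; exact: integrable_norm.
have k0 a b : a <= b -> tail k b <= tail k a.
  move=> ab; rewrite (tail_split intk ab) lerDr; apply: Rintegral_ge0 => x _.
  exact: normr_ge0.
have mk : measurable_fun `[0 : R, +oo[ k.
  by apply/measurable_EFinP; exact: (measurable_int mu (intk 0)).
have tk0 : tail k n%:R @[n --> \oo] --> (0 : R).
  (* Tails at [n] become integrals over a fixed domain of truncations of [k], each of which vanishes
     eventually at a given point, so dominated convergence applies. *)
  have -> : (fun n => tail k n%:R) = (fun n : nat => tail (k \_ `[n%:R : R, +oo[) 0).
    apply/funext => n; rewrite /tail -Rintegral_mkcondr; congr Rintegral.
    apply/seteqP; split => x /=; rewrite !in_itv/= !andbT; last by case.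
    by move=> nx; split => //; rewrite (le_trans _ nx).
  have H0 : tail (fun=> 0 : R) 0 = 0 by rewrite /tail Rintegral_cst// mul0r.
  have : tail (k \_ `[n%:R : R, +oo[) 0 @[n --> \oo] --> tail (fun=> 0 : R) 0;
    last by rewrite H0.
  apply: (@tail_dominated_ae _ _ k 0) => //.
  - move=> n; apply: (@measurable_funS _ _ _ _ setT) => //.
    apply/(measurable_restrictT _ _).1 => //; apply: measurable_funS mk => //.
    by apply: subset_itvr; rewrite bnd_simp.
  - move=> n x _; rewrite patchE; case: ifP => _; first by rewrite normr_id.
    by rewrite normr0 normr_ge0.
  - apply: aeW => x _; apply: (cvg_near_cst); near=> n.
    rewrite patchE memNset//= in_itv/= andbT; apply/negP; rewrite -ltNge.
    by near: n; exact: nbhs_infty_gtr.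
apply/cvgrPdist_lt => e e0; move/cvgrPdist_lt : tk0 => /(_ _ e0)[N _ HN].
near=> t; rewrite sub0r normrN.
have := HN N (leqnn N); rewrite /= sub0r normrN; apply: le_lt_trans.
have kt : `|tail f t| <= tail k t.
  have := @tail_norm f k 1 t intf intk; rewrite mul1r; apply => x _.
  by rewrite mul1r.
have Nt : N%:R <= t by near: t; apply: nbhs_pinfty_ge; rewrite num_real.
by rewrite (le_trans kt)// (le_trans (k0 _ _ Nt))// ler_norm.
Unshelve. all: by end_near. Qed.

End TailIntegral.

(** * Iterated tails of a weight and of the functions it dominates *)

Section IteratedTail.
Context {R : realType}.
Notation mu := (@lebesgue_measure R).
Implicit Types f k : R -> R.

Lemma integrable_itv_cst (c a b : R) : mu.-integrable `[a, b] (EFin \o cst c).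
Proof.
apply: continuous_compact_integrable; first exact: segment_compact.
by apply: continuous_subspaceT => x; exact: cvg_cst.
Qed.

Lemma Rintegral_itv_cst (c a b : R) : a <= b ->
  \int[mu]_(s in `[a, b]) c = c * (b - a).
Proof.
move=> ab; rewrite Rintegral_cst//; congr (_ * _).
rewrite (congr1 fine (lebesgue_measure_itv `[a, b]))/= lte_fin.
by case: ltgtP ab => // -> _; rewrite subrr.
Qed.

Definition itail (m : nat) f : R -> R := iter m tail f.

Lemma itailS m f : itail m.+1 f = tail (itail m f).
Proof. by []. Qed.

(** This is what Assumption 1 amounts to once [g] is extended to the whole line; see
    [assumption1_weight]. *)
Definition weight (r : nat) k := [/\ continuous k, forall t, 0 < k t,
  (forall s t, s <= t -> k t <= k s) &
  forall m, (m < r)%N -> tail_integrable (itail m k)].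

Definition dominated k (c : R) f :=
  measurable_fun setT f /\ forall x, `|f x| <= c * k x.

(** Source of the strict positivity of all iterated tails of [k]: the part of the integral over
    [[t, t + 1]] already exceeds the right end value, as [k] is non-increasing. *)
Lemma tail_ge_itv k t : (forall t, 0 < k t) -> (forall s t, s <= t -> k t <= k s) ->
  tail_integrable k -> k (t + 1) <= tail k t.
Proof.
move=> k0 kni intk; have t1 : t <= t + 1 by rewrite lerDl.
rewrite (tail_split intk t1) -[leLHS]addr0 lerD//; last first.
  by apply: Rintegral_ge0 => x _; exact: ltW.
have -> : k (t + 1) = \int[mu]_(s in `[t, t + 1]) k (t + 1).
  by rewrite Rintegral_itv_cst// addrAC subrr add0r mulr1.
apply: le_Rintegral => //.
- exact: integrable_itv_cst.
- by apply: tail_integrable_itv; exact: intk.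
- by move=> x /=; rewrite in_itv/= => /andP[_]; exact: kni.
Qed.

Lemma itail_weight r k m : weight r k -> (m <= r)%N ->
  (forall t, 0 < itail m k t) /\ (forall s t, s <= t -> itail m k t <= itail m k s).
Proof.
case=> _ k0 kni intk; elim: m => [//|m IHm] mr.
have [p0 ni] := IHm (ltnW mr); have im := intk _ mr.
split=> [t|s t st]; rewrite itailS.
  by rewrite (lt_le_trans (p0 (t + 1)))//; exact: tail_ge_itv.
rewrite (tail_split im st) lerDr; apply: Rintegral_ge0 => x _; exact: ltW.
Qed.

Lemma itail_gt0 r k m t : weight r k -> (m <= r)%N -> 0 < itail m k t.
Proof. by move=> W mr; have [] := itail_weight W mr. Qed.

Lemma itail_nincr r k m s t : weight r k -> (m <= r)%N -> s <= t ->
  itail m k t <= itail m k s.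
Proof. by move=> W mr; have [_] := itail_weight W mr; exact. Qed.

Lemma weight_dominated r k : weight r k -> dominated k 1 k.
Proof.
case=> ck k0 _ _; split; first exact: continuous_measurable_fun.
by move=> x; rewrite mul1r ger0_norm// ltW.
Qed.

Lemma itail_weight_continuous r k m : weight r k -> (m <= r)%N ->
  continuous (itail m k).
Proof.
case=> ck k0 kni intk; elim: m => [//|m IHm] mr t.
have := is_derive_tail (intk _ mr) (IHm (ltnW mr) t).
by move=> [/derivable1_diffP /differentiable_continuous].
Qed.

(** One induction for all three facts: measurability and the bound make the next tail well defined,
    and its continuity, inherited from the tail of [k], gives measurability again. At level 0 [f]
    may jump, whence [0 < m]. *)
Lemma dominated_itail r k (c : R) f m : weight r k -> 0 <= c -> dominated k c f -> (m <= r)%N ->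
  [/\ measurable_fun setT (itail m f), forall x, `|itail m f x| <= c * itail m k x &
   (0 < m)%N -> continuous (itail m f)].
Proof.
move=> W c0 [mf fk]; elim: m => [//|m IHm] mr.
have [mm mk _] := IHm (ltnW mr).
have [ck k0 kni intk] := W.
have intm : tail_integrable (itail m f) by exact: (tail_integrable_le mm mk (intk _ mr)).
have cont : continuous (itail m.+1 f).
  move=> t; have /(_ t) ct := itail_weight_continuous W mr.
  apply/cvgrPdist_lt => e e0.
  have c1 : 0 < c + 1 by rewrite ltr_wpDl.
  have e1 : 0 < e / (c + 1) by rewrite divr_gt0.
  move/cvgrPdist_lt : ct => /(_ _ e1); apply: filterS => x H.
  suff : `|itail m.+1 f t - itail m.+1 f x| <=
     c * `|itail m.+1 k t - itail m.+1 k x|.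
    move/le_lt_trans; apply; rewrite (@le_lt_trans _ _ ((c + 1) *
     `|itail m.+1 k t - itail m.+1 k x|))//.
      by rewrite ler_wpM2r// lerDl.
    by rewrite mulrC -ltr_pdivlMr.
  rewrite !itailS; have [tx|/ltW xt] := leP t x.
    apply: (le_trans (tail_diff_norm intm (intk _ mr) _ tx)) => [y _|].
      exact: mk.
    by rewrite ler_wpM2l// ler_norm.
  rewrite distrC [in leRHS]distrC.
  apply: (le_trans (tail_diff_norm intm (intk _ mr) _ xt)) => [y _|].
    exact: mk.
  by rewrite ler_wpM2l// ler_norm.
split=> //; first exact: continuous_measurable_fun.
by move=> x; apply: tail_norm => // [|y _]; [exact: intk|exact: mk].
Qed.

Lemma itail_integrable r k (c : R) f m : weight r k -> 0 <= c -> dominated k c f ->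
  (m < r)%N -> tail_integrable (itail m f).
Proof.
move=> W c0 df mr; have [mm mk _] := dominated_itail W c0 df (ltnW mr).
by have [_ _ _ intk] := W; exact: (tail_integrable_le mm mk (intk _ mr)).
Qed.

Lemma itail_norm r k (c : R) f m x : weight r k -> 0 <= c -> dominated k c f -> (m <= r)%N ->
  `|itail m f x| <= c * itail m k x.
Proof. by move=> W c0 df mr; have [] := dominated_itail W c0 df mr. Qed.

Lemma itail_continuous r k (c : R) f m : weight r k -> 0 <= c -> dominated k c f ->
  (0 < m <= r)%N -> continuous (itail m f).
Proof.
by move=> W c0 df /andP[m0 mr]; have [_ _] := dominated_itail W c0 df mr; exact.
Qed.

Lemma is_derive_itail r k (c : R) f m t : weight r k -> 0 <= c -> dominated k c f ->
  (m < r)%N -> (m = 0%N -> {for t, continuous f}) ->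
  is_derive t 1 (itail m.+1 f) (- itail m f t).
Proof.
move=> W c0 df mr cf; apply: is_derive_tail; first exact: itail_integrable df mr.
case: m mr cf => [|m] mr cf; first exact: cf.
have mr' : (0 < m.+1 <= r)%N by rewrite /= ltnW.
exact: (itail_continuous W c0 df mr' (x := t)).
Qed.

Lemma itail_cvg_at_oo r k (c : R) f m : weight r k -> 0 <= c -> dominated k c f ->
  (0 < m <= r)%N -> itail m f t @[t --> +oo] --> (0 : R).
Proof.
move=> W c0 df; case: m => // m /= mr; apply: tail_cvg_at_oo.
exact: itail_integrable df mr.
Qed.

Lemma dominatedB k (c c' : R) f f' : dominated k c f -> dominated k c' f' ->
  dominated k (c + c') (fun x => f x - f' x).
Proof.
move=> [mf fk] [mf' fk']; split; first exact: measurable_funB.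
by move=> x; rewrite (le_trans (ler_normB _ _))// mulrDl lerD.
Qed.

Lemma dominatedZ k (c : R) f (a : R) : dominated k c f ->
  dominated k (`|a| * c) (fun x => a * f x).
Proof.
move=> [mf fk]; split; first exact: measurable_funM.
by move=> x; rewrite normrM -mulrA ler_wpM2l.
Qed.

Lemma itailB r k (c c' : R) f f' m : weight r k -> 0 <= c -> 0 <= c' ->
  dominated k c f -> dominated k c' f' -> (m <= r)%N ->
  itail m (fun x => f x - f' x) = fun x => itail m f x - itail m f' x.
Proof.
move=> W c0 c'0 df df'; elim: m => [//|m IHm] mr.
rewrite itailS IHm ?(ltnW mr)//; apply/funext => x; apply: tailB.
  exact: itail_integrable df mr.
exact: itail_integrable df' mr.
Qed.

Lemma itailZ r k (c : R) f (a : R) m : weight r k -> 0 <= c -> dominated k c f -> (m <= r)%N ->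
  itail m (fun x => a * f x) = fun x => a * itail m f x.
Proof.
move=> W c0 df; elim: m => [//|m IHm] mr.
rewrite itailS IHm ?(ltnW mr)//; apply/funext => x; apply: tailZ.
exact: itail_integrable df mr.
Qed.

(** The constant depends on [f] only through [c]: functions dominated by the same multiple of [k]
    have equi-Lipschitz tails on the half-line. *)
Lemma itail_lipschitz r k (c : R) f m a b : weight r k -> 0 <= c -> dominated k c f ->
  (m < r)%N -> 0 <= a -> 0 <= b ->
  `|itail m.+1 f a - itail m.+1 f b| <= c * itail m k 0 * `|a - b|.
Proof.
move=> W c0 df mr; wlog ab : a b / a <= b.
  move=> H a0 b0; have [ab|/ltW ba] := leP a b; first exact: H.
  by rewrite distrC [in leRHS]distrC H.
move=> a0 b0.
have [_ _ _ intk] := W.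
apply: (le_trans (tail_diff_norm _ (intk _ mr) _ ab)).
- exact: itail_integrable df mr.
- by move=> x _; exact: (itail_norm x W c0 df (ltnW mr)).
rewrite -mulrA ler_wpM2l// (tail_split (intk _ mr) ab) addrK.
have -> : itail m k 0 * `|a - b| = \int[mu]_(s in `[a, b]) itail m k 0.
  by rewrite Rintegral_itv_cst// distrC ger0_norm// subr_ge0.
apply: le_Rintegral => //.
- by apply: tail_integrable_itv; exact: intk.
- exact: integrable_itv_cst.
- move=> x /=; rewrite in_itv/= => /andP[ax _].
  by apply: (itail_nincr W (ltnW mr)); exact: le_trans ax.
Qed.

Lemma itail_dominated_cvg r k (c : R) (f_ : nat -> R -> R) f m t : weight r k -> 0 <= c ->
  (forall n, dominated k c (f_ n)) -> dominated k c f ->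
  {ae mu, forall x, f_ n x @[n --> \oo] --> f x} -> (0 < m <= r)%N ->
  itail m (f_ n) t @[n --> \oo] --> itail m f t.
Proof.
move=> W c0 df_ df ff; case: m => // m /= mr.
(* One integration turns almost everywhere convergence into convergence at every point. *)
have step : {ae mu, forall x, itail m (f_ n) x @[n --> \oo] --> itail m f x} ->
    forall t, itail m.+1 (f_ n) t @[n --> \oo] --> itail m.+1 f t.
  move=> H s; rewrite itailS; have [_ _ _ intk] := W.
  apply: (tail_dominated_ae (tail_integrableZ c (intk _ mr))).
  - move=> n; apply: measurable_funTS.
    by have [] := dominated_itail W c0 (df_ n) (ltnW mr).
  - by apply: measurable_funTS; have [] := dominated_itail W c0 df (ltnW mr).
  - by move=> n x _; exact: (itail_norm x W c0 (df_ n) (ltnW mr)).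
  - by apply: (@filterS _ _ (ae_filter_ringOfSetsType mu) _ _ _ H) => x + _.
apply: step; elim: m mr {t} => [//|m IHm] mr.
apply: aeW => x; rewrite itailS; have [_ _ _ intk] := W.
apply: (tail_dominated_ae (tail_integrableZ c (intk _ (ltnW mr)))).
- move=> n; apply: measurable_funTS.
  by have [] := dominated_itail W c0 (df_ n) (ltnW (ltnW mr)).
- by apply: measurable_funTS; have [] := dominated_itail W c0 df (ltnW (ltnW mr)).
- by move=> n y _; exact: (itail_norm y W c0 (df_ n) (ltnW (ltnW mr))).
- by apply: (@filterS _ _ (ae_filter_ringOfSetsType mu) _ _ _ (IHm (ltnW mr))) => y + _.
Qed.

End IteratedTail.

(** * Sign alternations and zeros under iterated tails *)

Section Alternation.
Context {R : realType}.
Implicit Types (f F k : R -> R) (e c : R).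

(** The order is weak because the strict signs already separate the points; [e] is the sign at the
    first point. *)
Definition alternates F (n : nat) e := exists q : nat -> R,
  [/\ forall i, 0 <= q i, forall i, (i.+1 < n)%N -> q i <= q i.+1 &
      forall i, (i < n)%N -> 0 < e * (-1) ^+ i * F (q i)].

Lemma alternates_refine F f n n' e (q : nat -> R) : (n' <= n)%N ->
  (forall i, 0 <= q i) ->
  (forall i, (i < n')%N -> exists z, [/\ q i <= z, (i.+1 < n)%N -> z <= q i.+1 &
     0 < e * (-1) ^+ i * f z]) ->
  alternates f n' e.
Proof.
move=> n'n q0 H.
have /choice[z Hz] : forall i, exists z : R, 0 <= z /\ ((i < n')%N ->
    [/\ q i <= z, (i.+1 < n)%N -> z <= q i.+1 & 0 < e * (-1) ^+ i * f z]).
  move=> i; have [/H[z [qz zq fz]]|ni] := boolP (i < n')%N.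
    by exists z; split => //; exact: le_trans qz.
  by exists 0; split.
exists z; split => [i|i i1|i i1]; first by have [] := Hz i.
- have [_ /(_ (ltnW i1))[_ + _]] := Hz i; move=> /(_ (leq_trans i1 n'n)) zq.
  by have [_ /(_ i1)[qz _ _]] := Hz i.+1; exact: le_trans qz.
- by have [_ /(_ i1)[]] := Hz i.
Qed.

(** Between consecutive points the tail, up to the sign [s], decreases from positive to negative, so
    [s * f] is positive somewhere between. After the last point the tail goes to 0, which yields the
    last point for [f]. *)
Lemma alternates_tail f n e : tail_integrable f ->
  alternates (tail f) n e -> alternates f n e.
Proof.
move=> intf [q [q0 qq Hq]]; apply: (@alternates_refine (tail f) f n n e q) => // i ni.
pose s := e * (-1) ^+ i.
have ints : tail_integrable (fun x => s * f x) by exact: tail_integrableZ.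
have Hi : 0 < tail (fun x => s * f x) (q i) by rewrite tailZ//; exact: Hq.
have [i1|n1] := boolP (i.+1 < n)%N; last first.
  by have [z qz fz] := tail_gt0_ex ints Hi; exists z; split => // /negP.
have [|z /andP[qz zq] fz] := tail_diff_gt0_itv ints (qq _ i1); last by exists z; split.
apply: lt_trans Hi; rewrite tailZ// -oppr_gt0.
by have := Hq _ i1; rewrite exprS mulN1r mulrN mulNr.
Qed.

(** With a constant added, nothing is known beyond the last point, so that point is given up. *)
Lemma alternates_cst_tail f n e c : tail_integrable f ->
  alternates (fun t => c + tail f t) n.+1 e -> alternates f n e.
Proof.
move=> intf [q [q0 qq Hq]].
apply: (@alternates_refine (tail f) f n.+1 n e q) => // i ni.
pose s := e * (-1) ^+ i.
have ints : tail_integrable (fun x => s * f x) by exact: tail_integrableZ.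
have [|z /andP[qz zq] fz] := tail_diff_gt0_itv ints (qq _ (ni : (i.+1 < n.+1)%N)).
  rewrite !tailZ//.
  have := Hq _ (ltnW (ni : (i.+1 < n.+1)%N)); have := Hq _ (ni : (i.+1 < n.+1)%N).
  rewrite exprS mulN1r mulrN mulNr oppr_gt0 -/s !mulrDr => H1 H2.
  by rewrite -(ltrD2l (s * c)) (lt_trans H1).
by exists z; split.
Qed.

Lemma alternates_itail r k c f m n e : weight r k -> 0 <= c -> dominated k c f ->
  (m <= r)%N -> alternates (itail m f) n e -> alternates f n e.
Proof.
move=> W c0 df; elim: m => // m IHm mr /alternates_tail H.
by apply: IHm; [exact: ltnW|apply: H; exact: (itail_integrable W c0 df mr)].
Qed.

Lemma alternates_cst_itail r k c f m n e (a : R) : weight r k -> 0 <= c ->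
  dominated k c f -> (0 < m <= r)%N ->
  alternates (fun t => a + itail m f t) n.+1 e -> alternates f n e.
Proof.
move=> W c0 df; case: m => // m /= mr /alternates_cst_tail H.
apply: (alternates_itail W c0 df (ltnW mr)); apply: H.
exact: (itail_integrable W c0 df mr).
Qed.

Definition has_zeros F (n : nat) := exists q : nat -> R,
  [/\ forall i, 0 <= q i, forall i, (i.+1 < n)%N -> q i < q i.+1 &
      forall i, (i < n)%N -> F (q i) = 0].

Lemma tail_Rolle f a b : tail_integrable f -> continuous f -> a < b ->
  tail f a = tail f b -> exists2 z, a < z < b & f z = 0.
Proof.
move=> intf cf ab E.
have dt (x : R) : is_derive x 1 (tail f) (- f x) by apply: is_derive_tail => //; exact: cf.
have [z _||//|z zab dz] := @Rolle R (tail f) a b ab.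
- by have [] := dt z.
- by apply: derivable_within_continuous => z _; have [] := dt z.
- by exists z => //; apply/eqP; rewrite -oppr_eq0 -(@derive_val _ _ _ _ _ _ _ (dt z))
    (@derive_val _ _ _ _ _ _ _ dz).
Qed.

(** Rolle on [[a, +oo[]: the tail is 0 at [a] and tends to 0. If it is nonzero at [b], it moves away
    from 0 on [[a, b]] and back towards 0 on [[b, T]], so its derivative [- f] takes both signs. *)
Lemma tail_Rolle_oo f a : tail_integrable f -> continuous f ->
  tail f a = 0 -> exists2 z, a < z & f z = 0.
Proof.
move=> intf cf fa0; pose b := a + 1; have ab : a < b by rewrite ltrDl.
have dt (x : R) : is_derive x 1 (tail f) (- f x) by apply: is_derive_tail => //; exact: cf.
have mvt u v : u < v -> exists2 z, u < z < v & tail f v - tail f u = - f z * (v - u).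
  move=> uv; have [|z zuv Ez] := @MVT R (tail f) (fun x => - f x) u v uv (fun x _ => dt x).
    by apply: derivable_within_continuous => z _; have [] := dt z.
  by exists z.
have [E|nE] := eqVneq (tail f b) 0.
  have [|z /andP[az _] fz] := tail_Rolle intf cf ab; first by rewrite fa0 E.
  by exists z.
have [T bT HT] : exists2 T, b < T & `|tail f T| < `|tail f b|.
  have /cvgrPdist_lt/(_ `|tail f b|) := tail_cvg_at_oo intf.
  rewrite normr_gt0 => /(_ nE) H; near (pinfty_nbhs R) => T.
  exists T; first by near: T; apply: nbhs_pinfty_gt; rewrite num_real.
  by rewrite -normrN -[X in `|X|]sub0r; near: T.
have [z1 /andP[az1 z1b] E1] := mvt _ _ ab.
have [z2 /andP[bz2 z2T] E2] := mvt _ _ bT.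
have z12 : z1 <= z2 by rewrite ltW// (lt_trans z1b).
have ab0 : 0 < b - a by rewrite subr_gt0.
have bT0 : 0 < T - b by rewrite subr_gt0.
have [|] := IVT (v := 0) z12 (continuous_subspaceT cf).
  move: E1; rewrite fa0 subr0 => E1.
  have [d0|d0] := ltP 0 (tail f b).
    have f1 : f z1 < 0 by move: d0; rewrite E1 pmulr_lgt0// oppr_gt0.
    have f2 : 0 < f z2.
      have : - f z2 * (T - b) < 0.
        by rewrite -E2 subr_lt0 (le_lt_trans (ler_norm _))// (lt_le_trans HT)// ger0_norm// ltW.
      by rewrite pmulr_llt0// oppr_lt0.
    by rewrite ge_min le_max (ltW f1) (ltW f2) orbT.
  have {}d0 : tail f b < 0 by rewrite lt_neqAle nE.
  have f1 : 0 < f z1 by move: d0; rewrite E1 pmulr_llt0// oppr_lt0.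
  have f2 : f z2 < 0.
    have : 0 < - f z2 * (T - b).
      rewrite -E2 subr_gt0; move: HT; rewrite (ltr0_norm d0) => HT.
      by have := ler_norm (- tail f T); rewrite normrN; lra.
    by rewrite pmulr_lgt0// oppr_gt0.
  by rewrite ge_min le_max (ltW f1) (ltW f2) orbT.
move=> z; rewrite in_itv/= => /andP[z1z _] fz; exists z => //.
exact: lt_le_trans z1z.
Unshelve. all: by end_near. Qed.

(** Rolle between neighbours gives all zeros but one, and Rolle at infinity gives the one beyond the
    last point. *)
Lemma has_zeros_tail f n : tail_integrable f -> continuous f ->
  has_zeros (tail f) n -> has_zeros f n.
Proof.
move=> intf cf [q [q0 qq Hq]].
have /choice[z Hz] : forall i, exists z : R, 0 <= z /\ ((i < n)%N ->
    [/\ q i < z, (i.+1 < n)%N -> z < q i.+1 & f z = 0]).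
  move=> i; have [ni|ni] := boolP (i < n)%N; last by exists 0; split.
  have [i1|n1] := boolP (i.+1 < n)%N; last first.
    have [z qz fz] := tail_Rolle_oo intf cf (Hq _ ni); exists z; split.
      by rewrite ltW// (le_lt_trans _ qz).
    by move=> _; split => // /negP.
  have [|z /andP[qz zq] fz] := tail_Rolle intf cf (qq _ i1); first by rewrite !Hq.
  by exists z; split => //; rewrite ltW// (le_lt_trans _ qz).
exists z; split => [i|i i1|i i1]; first by have [] := Hz i.
- have [_ /(_ (ltnW i1))[_ + _]] := Hz i; move=> /(_ i1) zq.
  by have [_ /(_ i1)[qz _ _]] := Hz i.+1; exact: lt_trans qz.
- by have [_ /(_ i1)[]] := Hz i.
Qed.

Lemma has_zeros_itail r k c f m n : weight r k -> 0 <= c -> dominated k c f ->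
  continuous f -> (m <= r)%N -> has_zeros (itail m f) n -> has_zeros f n.
Proof.
move=> W c0 df cf; elim: m => // m IHm mr /has_zeros_tail H.
apply: IHm; [exact: ltnW|apply: H; first exact: (itail_integrable W c0 df mr)].
case: m mr => // m mr.
have mr' : (0 < m.+1 <= r)%N by rewrite /= ltnW.
exact: (itail_continuous W c0 df mr').
Qed.

End Alternation.

Lemma cvgr_prod {R : realType} {T I : Type} (F : set_system T) {FF : Filter F}
    (s : seq I) (f : I -> T -> R) (l : I -> R) :
  (forall j, f j t @[t --> F] --> l j) ->
  \prod_(j <- s) f j t @[t --> F] --> \prod_(j <- s) l j.
Proof.
move=> fl; elim: s => [|j s IHs].
  by rewrite big_nil; under eq_fun do rewrite big_nil; exact: cvg_cst.
by rewrite big_cons; under eq_fun do rewrite big_cons; exact: cvgM.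
Qed.

(** * The bounded coordinate for knots and the sign they determine *)

Section Knots.
Context {R : realType}.
Implicit Types (u t : R).

(* Knots are handled through this bounded coordinate, in which the knot [+oo] is [1]. *)
Definition squash u : R := u / (1 + `|u|).

Let den_gt0 u : 0 < 1 + `|u|.
Proof. by rewrite ltr_wpDr. Qed.

Lemma continuous_squash : continuous squash.
Proof.
move=> u; apply: cvgM; first exact: cvg_id.
apply: cvgV; first by rewrite gt_eqF.
by apply: cvgD; [exact: cvg_cst|exact: cvg_norm].
Qed.

Lemma squash_ge0 u : 0 <= u -> 0 <= squash u.
Proof. by move=> u0; rewrite divr_ge0// ltW. Qed.

Lemma squash_lt1 u : squash u < 1.
Proof.
rewrite /squash ltr_pdivrMr// mul1r (le_lt_trans (ler_norm _))//.
by rewrite ltrDr.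
Qed.

Lemma squash_norm u : `|squash u| <= 1.
Proof.
rewrite normrM normfV (gtr0_norm (den_gt0 u)) ler_pdivrMr// mul1r.
by rewrite lerDr.
Qed.

Lemma squash_lt s u : 0 <= s -> s < u -> squash s < squash u.
Proof.
move=> s0 su; have u0 : 0 < u by exact: le_lt_trans su.
rewrite /squash (ger0_norm s0) (gtr0_norm u0) ltr_pdivrMr ?ltr_wpDr//.
by rewrite mulrAC ltr_pdivlMr ?ltr_wpDr ?ltW// !mulrDr !mulr1 mulrC ltrD2r.
Qed.

Lemma squash_le s u : 0 <= s -> s <= u -> squash s <= squash u.
Proof.
move=> s0; rewrite le_eqVlt => /predU1P[->//|su].
exact/ltW/squash_lt.
Qed.

Definition unsquash t : R := t / (1 - t).

Lemma unsquash_ge0 t : 0 <= t < 1 -> 0 <= unsquash t.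
Proof. by case/andP=> t0 t1; rewrite divr_ge0// subr_ge0 ltW. Qed.

Lemma unsquashK t : 0 <= t < 1 -> squash (unsquash t) = t.
Proof.
move=> /[dup] tt /andP[t0 t1].
rewrite /squash (ger0_norm (unsquash_ge0 tt)) /unsquash.
have t1' : 1 - t != 0 by rewrite subr_eq0 eq_sym lt_eqF.
by field; rewrite t1' /= subrK oner_neq0.
Qed.

Lemma squashK u : 0 <= u -> unsquash (squash u) = u.
Proof.
move=> u0; rewrite /unsquash /squash ger0_norm//.
have u1 : 1 + u != 0 by rewrite gt_eqF// ltr_wpDr.
by field; rewrite u1 /= addrK oner_neq0.
Qed.

Lemma lt_squash t u : 0 <= t < 1 -> 0 <= u -> (t < squash u) = (unsquash t < u).
Proof.
move=> tt u0; have w0 := unsquash_ge0 tt.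
have [wu|uw] := ltP (unsquash t) u; first by rewrite -(unsquashK tt) squash_lt.
by apply/negbTE; rewrite -leNgt -[leRHS](unsquashK tt) squash_le.
Qed.

Lemma squash_lt_knot t u : 0 <= t < 1 -> 0 <= u -> (squash u < t) = (u < unsquash t).
Proof.
move=> tt u0; have w0 := unsquash_ge0 tt.
have [wu|uw] := ltP u (unsquash t); first by rewrite -(unsquashK tt) squash_lt.
by apply/negbTE; rewrite -leNgt -[leLHS](unsquashK tt) squash_le.
Qed.

Section Sign.
Variables (n : nat).
Implicit Type x : 'I_n -> R.

Definition nknots x u : nat := \sum_(j < n) (x j <= squash u)%R.

Definition knot_sign x u : R := \prod_(j < n) (if squash u < x j then 1 else -1).

Definition knot_poly x u : R := \prod_(j < n) (x j - squash u).

Lemma nknots_le x s u : 0 <= s -> s <= u -> (nknots x s <= nknots x u)%N.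
Proof.
move=> s0 su; apply: leq_sum => j _.
by case: (leP (x j) (squash s)) => // xs; rewrite (le_trans xs)// squash_le.
Qed.

Lemma nknots_max x u : (nknots x u <= n)%N.
Proof.
rewrite -[leqRHS]card_ord -sum1_card; apply: leq_sum => j _; exact: leq_b1.
Qed.

Lemma knot_signE x u : knot_sign x u = (-1) ^+ nknots x u.
Proof.
rewrite /nknots expr_sum; apply: eq_bigr => j _.
by case: leP; rewrite ?expr1 ?expr0.
Qed.

Lemma knot_sign_norm x u : `|knot_sign x u| = 1.
Proof. by rewrite knot_signE normrX normrN1 expr1n. Qed.

(** The product is a continuous function with the sign pattern of [knot_sign], multiple knots
    included; this is what makes it suitable for smoothing. *)
Lemma knot_polyE x u : knot_poly x u = knot_sign x u * `|knot_poly x u|.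
Proof.
rewrite /knot_poly normr_prod -big_split/=; apply: eq_bigr => j _.
case: ltP => H; first by rewrite mul1r gtr0_norm// subr_gt0.
by rewrite mulN1r ler0_norm ?opprK// subr_le0.
Qed.

Lemma measurable_squash : measurable_fun setT squash.
Proof. exact: continuous_measurable_fun continuous_squash. Qed.

Lemma measurable_knot_sign x : measurable_fun setT (knot_sign x).
Proof.
apply: measurable_prod => j _; apply: measurable_fun_ifT => //.
apply: measurable_fun_ltr => //; exact: measurable_squash.
Qed.

Lemma continuous_knot_poly x : continuous (knot_poly x).
Proof.
move=> u; apply: cvgr_prod => j.
by apply: cvgB; [exact: cvg_cst|exact: continuous_squash].
Qed.

End Sign.

(** A nondecreasing sequence whose parity flips at each step grows by at least 1 each time; for
    [b = 1] it starts odd, hence at 1 or more. *)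
Lemma alternating_parity_ge (N : nat -> nat) (b m i : nat) : (b <= 1)%N ->
  (forall i, (i.+1 < m)%N -> (N i <= N i.+1)%N) ->
  (forall i, (i < m)%N -> (-1) ^+ N i = (-1) ^+ (i + b) :> R) ->
  (i < m)%N -> (i + b <= N i)%N.
Proof.
move=> b1 mono H; have par j : (j < m)%N -> odd (N j) = odd (j + b).
  by move=> /H; rewrite -signr_odd -[RHS]signr_odd => /signr_inj.
elim: i => [|i IHi] im.
  by have := par _ im; case: b b1 {H par} => [|[|//]] _ //=; case: (N 0%N).
have := IHi (ltnW im); have := mono _ im; move=> H1 H2.
have := leq_trans H2 H1; rewrite leq_eqVlt addSn => /predU1P[E|//].
by have := par _ im; rewrite -E addSn/=; case: odd.
Qed.

End Knots.

(** * Counting knots by alternations, and comparing two splines *)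

Section Comparison.
Context {R : realType}.

Section KnotCount.
Variables (n : nat) (x : 'I_n -> R) (q : nat -> R).
Hypothesis q0 : forall i, 0 <= q i.

(** The sign is 1 before the first knot, so [m] alternations take [m - 1] knots, and one more if
    they start with the sign -1. *)
Lemma nknots_ge m b : (b <= 1)%N -> (forall i, (i.+1 < m)%N -> q i <= q i.+1) ->
  (forall i, (i < m)%N -> knot_sign x (q i) = (-1) ^+ (i + b)) ->
  (m + b <= n.+1)%N.
Proof.
move=> b1 qq H; case: m qq H => [|m] qq H; first by rewrite add0n (leq_trans b1).
have := @alternating_parity_ge R (fun i => nknots x (q i)) b m.+1 m b1.
rewrite addSn ltnS => /(_ _ _ _)/leq_trans; apply; last exact: nknots_max.
- by move=> i im; apply: nknots_le => //; exact: qq.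
- by move=> i im; rewrite -knot_signE H.
- exact: ltnSn.
Qed.

(** Parity bounds the count from below going up from the first point, and from above going down from
    the last point, where it is at most [n]. *)
Lemma nknots_exact : (forall i, (i < n)%N -> q i <= q i.+1) ->
  (forall i, (i <= n)%N -> knot_sign x (q i) = (-1) ^+ i) ->
  forall i, (i <= n)%N -> nknots x (q i) = i.
Proof.
move=> qq H.
have mono i : (i < n)%N -> (nknots x (q i) <= nknots x (q i.+1))%N.
  by move=> im; apply: nknots_le => //; exact: qq.
have lo i : (i <= n)%N -> (i <= nknots x (q i))%N.
  move=> im; rewrite -[leqLHS]addn0.
  apply: (@alternating_parity_ge R (fun i => nknots x (q i)) 0 n.+1) => // j jm.
  by rewrite -knot_signE addn0 H.
have par i : (i <= n)%N -> odd (nknots x (q i)) = odd i.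
  move=> /H; rewrite knot_signE -signr_odd -[RHS]signr_odd => /signr_inj; exact.
have hi d : (d <= n)%N -> (nknots x (q (n - d)) <= n - d)%N.
  elim: d => [|d IHd] dn; first by rewrite subn0 nknots_max.
  have E : (n - d = (n - d.+1).+1)%N by rewrite subnSK.
  have := IHd (ltnW dn); have nd : (n - d.+1 < n)%N by rewrite ltn_subrL (leq_ltn_trans _ dn).
  rewrite E => H1; have := leq_trans (mono _ nd) H1.
  rewrite leq_eqVlt => /predU1P[E'|//].
  by have := par _ (ltnW nd); rewrite E'/=; case: odd.
by move=> i im; apply/eqP; rewrite eqn_leq lo// andbT -(subKn im) hi// leq_subr.
Qed.

(** The alternations use up all [n] knots: each lies after the first point and not after the last
    one, and each step passes exactly one of them. *)
Lemma knots_interior : (forall i, (i < n)%N -> q i <= q i.+1) ->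
  (forall i, (i <= n)%N -> knot_sign x (q i) = (-1) ^+ i) ->
  (forall j, 0 < x j < 1) /\ injective x.
Proof.
move=> qq H; have ex := nknots_exact qq H.
have below j : x j <= squash (q n).
  rewrite leNgt; apply/negP => xj; have := ex _ (leqnn n).
  rewrite /nknots (bigD1 j)//= leNgt xj/= add0n => E.
  have : (n <= \sum_(i < n | i != j) 1)%N.
    by rewrite -[leqLHS]E; apply: leq_sum => i _; exact: leq_b1.
  by rewrite sum1_card cardC1 card_ord; case: (n) j {E xj} => [[]//|m] _; rewrite ltnn.
have above j : squash (q 0%N) < x j.
  rewrite ltNge; apply/negP => xj; have := ex _ (leq0n n).
  by rewrite /nknots (bigD1 j)//= xj.
split=> [j|j j' E].
  rewrite (le_lt_trans _ (above j))/=; last exact: squash_ge0.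
  by rewrite (le_lt_trans (below j))// squash_lt1.
apply/eqP/negPn/negP => jj'.
(* The first point at or past the common value of two equal knots: the count would rise by at least
   2 in the step leading to it. *)
have exi : exists i, (i <= n)%N && (x j <= squash (q i)) by exists n; rewrite leqnn below.
have [i /andP[im xi] mini] := ex_minnP exi.
case: i im xi mini => [|i] im xi mini; first by move: xi; rewrite leNgt above.
have xi' : ~~ (x j <= squash (q i)).
  by apply/negP => xi'; have := mini i; rewrite (ltnW im) xi' ltnn; exact/implyP.
have : (\sum_(l < n) ((x l <= squash (q i))%R + (l == j) + (l == j')) <= i.+1)%N.
  rewrite -(ex _ im); apply: leq_sum => l _.
  have [->|lj] := eqVneq l j; first by rewrite (negbTE xi') (negbTE jj') xi.
  have [->|lj'] := eqVneq l j'; first by rewrite -E (negbTE xi') xi.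
  rewrite !addn0; case: (boolP (x l <= squash (q i))) => // xl.
  by rewrite (le_trans xl)// squash_le// qq.
rewrite big_split big_split/= -[X in (X + _ + _)%N]/(nknots x (q i)) (ex _ (ltnW im)).
have s1 (l0 : 'I_n) : (\sum_(l < n) (l == l0) = 1)%N.
  by rewrite (bigD1 l0)//= eqxx big1// => l /negbTE ->.
by rewrite !s1 addn1 addn1 ltnn.
Qed.

End KnotCount.

Variables (r : nat) (k : R -> R).
Hypotheses (W : weight r k) (r0 : (0 < r)%N).

Definition signed_weight n (x : 'I_n -> R) u := k u * knot_sign x u.

Definition spline n (x : 'I_n -> R) : R -> R := itail r (signed_weight x).

Lemma signed_weight_dominated n (x : 'I_n -> R) : dominated k 1 (signed_weight x).
Proof.
have [ck k0 _ _] := W; split.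
  by apply: measurable_funM; [exact: continuous_measurable_fun|exact: measurable_knot_sign].
by move=> u; rewrite normrM knot_sign_norm mulr1 mul1r gtr0_norm.
Qed.

Lemma sign_sub_gt0 (s1 s2 : bool) i : 0 < (-1) ^+ i * ((-1) ^+ s2 - (-1) ^+ s1) :> R ->
  (-1) ^+ s1 = (-1) ^+ (i + 1) :> R.
Proof.
rewrite addn1 exprS -signr_odd; case: s1 s2 (odd i) => [] [] [] /=;
  rewrite ?expr0 ?expr1; lra.
Qed.

(** Only the knots of [x1] are counted: where the difference of the two signs is nonzero, the sign
    of [x1] is opposite to it. So that sign alternates [m] times starting from -1, which takes [m]
    knots. *)
Lemma alternates_signed_weightB n1 n2 (x1 : 'I_n1 -> R) (x2 : 'I_n2 -> R) m :
  alternates (fun u => signed_weight x2 u - signed_weight x1 u) m 1 -> (m <= n1)%N.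
Proof.
have [_ k0 _ _] := W.
move=> [q [q0 qq Hq]]; rewrite -ltnS -addn1; apply: (@nknots_ge _ x1 q q0 m 1) => // i im.
have := Hq _ im; rewrite /signed_weight -mulrBr mul1r mulrCA pmulr_rgt0//.
by rewrite !knot_signE -(signr_odd _ (nknots x1 _)) -(signr_odd _ (nknots x2 _)) => /sign_sub_gt0.
Qed.

Lemma splineB n1 n2 (x1 : 'I_n1 -> R) (x2 : 'I_n2 -> R) :
  itail r (fun u => signed_weight x2 u - signed_weight x1 u) =
  fun t => spline x2 t - spline x1 t.
Proof.
by apply: (itailB W ler01 ler01) => //; exact: signed_weight_dominated.
Qed.

Lemma dominated_signed_weightB n1 n2 (x1 : 'I_n1 -> R) (x2 : 'I_n2 -> R) :
  dominated k 2 (fun u => signed_weight x2 u - signed_weight x1 u).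
Proof. by apply: dominatedB; exact: signed_weight_dominated. Qed.

Lemma alternates_splineB n1 n2 (x1 : 'I_n1 -> R) (x2 : 'I_n2 -> R) m :
  alternates (fun t => spline x2 t - spline x1 t) m 1 -> (m <= n1)%N.
Proof.
rewrite -splineB => /(alternates_itail W (ler0n _ 2)
  (dominated_signed_weightB x1 x2) (leqnn r)); exact: alternates_signed_weightB.
Qed.

Lemma alternates_cst_splineB n1 n2 (x1 : 'I_n1 -> R) (x2 : 'I_n2 -> R) m a :
  alternates (fun t => a + (spline x2 t - spline x1 t)) m.+1 1 -> (m <= n1)%N.
Proof.
have -> : (fun t => a + (spline x2 t - spline x1 t)) = fun t => a +
  itail r (fun u => signed_weight x2 u - signed_weight x1 u) t by rewrite splineB.
have rr : (0 < r <= r)%N by rewrite r0 leqnn.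
move=> /(alternates_cst_itail W (ler0n _ 2) (dominated_signed_weightB x1 x2) rr).
exact: alternates_signed_weightB.
Qed.

(** The constant costs one alternation, and the [n + 1] that remain are the most that [n] knots
    allow. *)
Lemma spline_knots_interior n (x : 'I_n -> R) a :
  alternates (fun t => a + spline x t) n.+2 1 ->
  (forall j, 0 < x j < 1) /\ injective x.
Proof.
have [_ k0 _ _] := W.
have rr : (0 < r <= r)%N by rewrite r0 leqnn.
move=> /(alternates_cst_itail W ler01 (signed_weight_dominated x) rr).
move=> [q [q0 qq Hq]]; apply: (@knots_interior _ x q q0) => // i im.
have := Hq _ (im : (i < n.+1)%N); rewrite mul1r mulrCA pmulr_rgt0//.
rewrite knot_signE -(signr_odd _ (nknots _ _)) -signr_odd.
by do 2 case: odd; rewrite /= ?expr1 ?expr0; lra.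
Qed.

Lemma spline_cvg_at_oo n (x : 'I_n -> R) : spline x t @[t --> +oo] --> (0 : R).
Proof.
apply: (itail_cvg_at_oo W ler01 (signed_weight_dominated x)).
by rewrite r0 leqnn.
Qed.

End Comparison.

(** * Smoothed signs and the splines built from them *)

Section SmoothedSign.
Context {R : realType}.

Lemma squash_mono_sign (a b : R) : squash b - squash a =
  (b - a + (b * `|a| - a * `|b|)) / ((1 + `|a|) * (1 + `|b|)).
Proof.
have a0 : 1 + `|a| != 0 by rewrite gt_eqF// ltr_wpDr.
have b0 : 1 + `|b| != 0 by rewrite gt_eqF// ltr_wpDr.
by rewrite /squash; field; rewrite a0 b0.
Qed.

Lemma squash_lipschitz (a b : R) : `|squash b - squash a| <= `|b - a|.
Proof.
have pos (x : R) : 0 < 1 + `|x| by rewrite ltr_wpDr.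
have H (x : R) : `|squash x| <= `|x|.
  rewrite /squash normrM normfV (gtr0_norm (pos x)) ler_pdivrMr// ler_peMr//.
  by rewrite lerDl.
have sg (x : R) : (0 <= x -> 0 <= squash x) /\ (x <= 0 -> squash x <= 0).
  split=> x0; first exact: squash_ge0.
  by rewrite mulr_le0_ge0// invr_ge0 ltW.
(* For [a] and [b] of the same sign the cross term of [squash_mono_sign] vanishes; for opposite
   signs the bound [H] at each of them suffices. *)
have same : b * `|a| = a * `|b| -> `|squash b - squash a| <= `|b - a|.
  move=> E; rewrite squash_mono_sign E subrr addr0 normrM normfV.
  rewrite (gtr0_norm (mulr_gt0 (pos a) (pos b))) ler_pdivrMr ?mulr_gt0// ler_peMr//.
  by rewrite mulr_ege1// lerDl.
have [a0|/ltW a0] := leP 0 a; have [b0|/ltW b0] := leP 0 b.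
- by apply: same; rewrite !ger0_norm// mulrC.
- have [/(_ a0) sa _] := sg a; have [_ /(_ b0) sb] := sg b.
  rewrite ler0_norm ?ler0_norm; [|lra|lra].
  by have := H a; have := H b;
    rewrite !(ger0_norm sa, ger0_norm a0, ler0_norm sb, ler0_norm b0); lra.
- have [_ /(_ a0) sa] := sg a; have [/(_ b0) sb _] := sg b.
  rewrite ger0_norm ?ger0_norm; [|lra|lra].
  by have := H a; have := H b;
    rewrite !(ler0_norm sa, ler0_norm a0, ger0_norm sb, ger0_norm b0); lra.
- by apply: same; rewrite !ler0_norm// !mulrN mulrC.
Qed.

(** The chain rule for [squash] along a sequence: its derivative at [a] is [1 / (1 + |a|) ^ 2]. *)
Lemma squash_diff_cvg (a l : R) (b h : nat -> R) : b N @[N --> \oo] --> a ->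
  (b N - a) / h N @[N --> \oo] --> l ->
  (squash (b N) - squash a) / h N @[N --> \oo] --> l / (1 + `|a|) ^+ 2.
Proof.
move=> ba bl.
have pos (x : R) : 0 < 1 + `|x| by rewrite ltr_wpDr.
have H : (b N - a) / h N / ((1 + `|a|) * (1 + `|b N|)) @[N --> \oo] -->
    l / (1 + `|a|) ^+ 2.
  apply: cvgM => //; apply: cvgV; first by rewrite gt_eqF// exprn_gt0.
  by rewrite expr2; apply: cvgMr; apply: cvgD; [exact: cvg_cst|exact: cvg_norm].
apply: cvg_trans H; apply: near_eq_cvg.
(* Either [a = 0] or [b N] eventually has the sign of [a], so the cross term is eventually 0. *)
have E : \forall N \near \oo, b N * `|a| - a * `|b N| = 0.
  have [->|a0] := eqVneq a 0; first by apply: nearW => N; rewrite normr0; ring.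
  have a0' : 0 < `|a| by rewrite normr_gt0.
  move/cvgrPdist_lt : ba => /(_ _ a0'); apply: filterS => N.
  have [{}a0|{}a0] : 0 < a \/ a < 0 by move: a0; rewrite neq_lt => /orP[]; tauto.
    rewrite (gtr0_norm a0) ltr_norml => /andP[H1 H2].
    by rewrite gtr0_norm; [ring|lra].
  rewrite (ltr0_norm a0) ltr_norml => /andP[H1 H2].
  by rewrite ltr0_norm; [ring|lra].
apply: filterS E => N E; rewrite squash_mono_sign E addr0.
by rewrite -!mulrA; congr (_ * _); rewrite mulrC.
Qed.

Variables (r : nat) (k : R -> R).
Hypotheses (W : weight r k) (r0 : (0 < r)%N).

(** In the end [w] is a large constant. It is allowed to be a function so that the factor of a knot
    at infinity can be absorbed into it, as the induction in [smooth_spline_alternates] requires. *)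
Definition smooth_weight (w : R -> R) n (x : 'I_n -> R) u :=
  k u * squash (w u * knot_poly x u).

Definition smooth_spline w n (x : 'I_n -> R) : R -> R := itail r (smooth_weight w x).

Lemma continuous_smooth_weight (w : R -> R) n (x : 'I_n -> R) : continuous w ->
  continuous (smooth_weight w x).
Proof.
have [ck _ _ _] := W.
move=> cw u; apply: cvgM; first exact: ck.
apply: (@continuous_comp _ _ _ (fun u => w u * knot_poly x u) squash);
  last exact: continuous_squash.
by apply: cvgM; [exact: cw|exact: continuous_knot_poly].
Qed.

Lemma smooth_weight_dominated (w : R -> R) n (x : 'I_n -> R) : continuous w ->
  dominated k 1 (smooth_weight w x).
Proof.
have [ck k0 _ _] := W.
move=> cw; split.
  by apply: continuous_measurable_fun; exact: continuous_smooth_weight.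
by move=> u; rewrite normrM mul1r gtr0_norm// ler_piMr ?squash_norm// ltW.
Qed.

Lemma smooth_weight_sign (w : R -> R) n (x : 'I_n -> R) u (i : nat) : 0 < w u ->
  0 < (-1) ^+ i * smooth_weight w x u -> knot_sign x u = (-1) ^+ i.
Proof.
have [_ k0 _ _] := W; have pos (y : R) : 0 < 1 + `|y| by rewrite ltr_wpDr.
move=> w0; rewrite /smooth_weight mulrCA pmulr_rgt0// /squash mulrA.
rewrite pmulr_lgt0 ?invr_gt0// mulrCA pmulr_rgt0//.
rewrite knot_polyE mulrA => H.
have {H} : 0 < (-1) ^+ i * knot_sign x u.
  have [E|P0] := eqVneq (knot_poly x u) 0; first by move: H; rewrite E normr0 mulr0 ltxx.
  by move: H; rewrite pmulr_lgt0// normr_gt0.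
rewrite knot_signE -(signr_odd _ i) -(signr_odd _ (nknots x u)).
by do 2 case: odd; rewrite /= ?expr1 ?expr0; lra.
Qed.

(** Where the smoothed weight is nonzero it has the sign [knot_sign], so the counts for sharp knots
    apply unchanged; [b] records the sign at the first point. *)
Lemma alternates_smooth_spline (w : R -> R) n (x : 'I_n -> R) m (b : bool) : continuous w ->
  (forall u, 0 < w u) ->
  alternates (smooth_spline w x) m ((-1) ^+ b) ->
  (m + b <= n.+1)%N /\ (m = n.+1 -> (forall j, 0 < x j < 1) /\ injective x).
Proof.
move=> cw w0 /(alternates_itail W ler01 (smooth_weight_dominated x cw) (leqnn r)).
move=> [q [q0 qq Hq]].
have sg i : (i < m)%N -> knot_sign x (q i) = (-1) ^+ (i + b).
  move=> im; apply: (smooth_weight_sign (w0 _)).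
  by rewrite addnC exprD; exact: Hq.
have mb : (m + b <= n.+1)%N by apply: (nknots_ge q0 _ qq sg); case: (b).
split=> // E; move: mb; rewrite E -[leqRHS]addn0 leq_add2l leqn0 => /eqP b0.
apply: (knots_interior q0) => i im; last by rewrite sg ?E ?b0 ?addn0.
by apply: qq; rewrite E ltnS.
Qed.

Lemma smooth_spline_norm (w : R -> R) n (x : 'I_n -> R) t : continuous w ->
  `|smooth_spline w x t| <= itail r k t.
Proof.
move=> cw; rewrite -[leRHS]mul1r.
exact: (itail_norm t W ler01 (smooth_weight_dominated x cw) (leqnn r)).
Qed.

(* Pointwise convergence and equi-Lipschitz continuity give continuous convergence. *)
Lemma itail_cvg_comp (f_ : nat -> R -> R) f (p_ : nat -> R) (p : R) :
  (forall N, dominated k 1 (f_ N)) -> dominated k 1 f ->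
  {ae lebesgue_measure, forall u, f_ N u @[N --> \oo] --> f u} ->
  (forall N, 0 <= p_ N) -> 0 <= p -> p_ N @[N --> \oo] --> p ->
  itail r (f_ N) (p_ N) @[N --> \oo] --> itail r f p.
Proof.
move=> df_ df ff p_0 p0 pp; have rr : (0 < r <= r)%N by rewrite r0 leqnn.
have H := itail_dominated_cvg (t := p) W ler01 df_ df ff rr.
have Z : itail r (f_ N) (p_ N) - itail r (f_ N) p @[N --> \oo] --> (0 : R).
  have L : 1 * itail r.-1 k 0 * `|p_ N - p| @[N --> \oo] --> (0 : R).
    rewrite -[X in _ --> X](mulr0 (1 * itail r.-1 k 0)); apply: cvgMr.
    by apply/norm_cvg0P; apply/subr_cvg0.
  apply/norm_cvg0P; apply: (squeeze_cvgr _ (cvg_cst 0) L).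
  apply: nearW => N; rewrite normr_ge0/=.
  have r1 : (r.-1 < r)%N by rewrite prednK.
  by have := itail_lipschitz W ler01 (df_ N) r1 (p_0 N) p0; rewrite prednK.
rewrite -[X in _ --> X]add0r.
have -> : (fun N => itail r (f_ N) (p_ N)) =
    fun N => (itail r (f_ N) (p_ N) - itail r (f_ N) p) + itail r (f_ N) p.
  by apply/funext => N; rewrite subrK.
exact: cvgD.
Qed.

Lemma smooth_weight_cvg (w : R -> R) n (x_ : nat -> 'I_n -> R) (x : 'I_n -> R) u :
  (forall j, x_ N j @[N --> \oo] --> x j) ->
  smooth_weight w (x_ N) u @[N --> \oo] --> smooth_weight w x u.
Proof.
move=> xx; apply: cvgMr.
apply: (@continuous_cvg _ _ _ _ _ _ squash); first exact: continuous_squash.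
by apply: cvgMr; apply: cvgr_prod => j; apply: cvgB; [exact: xx|exact: cvg_cst].
Qed.

(** By the mean value theorem each tail decreases strictly from [t] to [t + 1], where it is still
    nonnegative. *)
Lemma itail_gt0_on m (f : R -> R) (c U t : R) : 0 <= c -> dominated k c f -> continuous f ->
  (m <= r)%N -> (forall u, U <= u -> 0 < f u) -> U <= t -> 0 < itail m f t.
Proof.
move=> c0 df cf mr fU; elim: m mr t => [|m IHm] mr t Ut; first exact: (fU t Ut).
have intf := itail_integrable W c0 df mr.
have cm : continuous (itail m f).
  case: m {IHm} mr intf => // m mr _.
  have mr' : (0 < m.+1 <= r)%N by rewrite /= ltnW.
  exact: (itail_continuous W c0 df mr').
have t1 : t < t + 1 by rewrite ltrDl.
have dt (x : R) : is_derive x 1 (tail (itail m f)) (- itail m f x).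
  by apply: is_derive_tail => //; exact: cm.
have [|z /itvP zt Ez] := @MVT R _ (fun x => - itail m f x) _ _ t1 (fun x _ => dt x).
  by apply: derivable_within_continuous => z _; have [] := dt z.
have f0 (u : R) : U <= u -> 0 < itail m f u by move=> Uu; exact: (IHm (ltnW mr) u Uu).
have : 0 <= tail (itail m f) (t + 1).
  apply: Rintegral_ge0 => x /=; rewrite in_itv/= andbT => tx.
  by apply/ltW/f0; rewrite (le_trans Ut)// (le_trans _ tx)// ltW.
have := f0 z; rewrite (le_trans Ut) ?zt// => /(_ isT).
move: Ez; rewrite itailS addrAC subrr add0r mulr1; lra.
Qed.

Definition cons_knot n (t : R) (x : 'I_n -> R) (j : 'I_n.+1) : R :=
  if unlift ord0 j is Some i then x i else t.

Lemma knot_poly_cons n t (x : 'I_n -> R) u :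
  knot_poly (cons_knot t x) u = (t - squash u) * knot_poly x u.
Proof.
rewrite /knot_poly big_ord_recl /cons_knot unlift_none; congr (_ * _).
by apply: eq_bigr => j _; rewrite liftK.
Qed.

(** Induction on the number of knots, for all [w]. When a new knot tends to 1, its factor tends to
    [1 - squash u], which is positive and is absorbed into [w']; so the alternations for [w'] and
    the old knots persist when the new knot is close to 1. As that knot is finite, the sign changes
    once more after it. *)
Lemma smooth_spline_alternates n (w : R -> R) : continuous w -> (forall u, 0 < w u) ->
  exists x : 'I_n -> R, (forall j, 0 <= x j < 1) /\ alternates (smooth_spline w x) n.+1 1.
Proof.
have [_ k0 _ _] := W.
elim: n w => [|n IHn] w cw w0.
  exists (fun=> 0); split=> [[]//|]; exists (fun=> 0); split => // i.
  rewrite ltnS leqn0 => /eqP ->; rewrite expr0 !mul1r.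
  apply: (itail_gt0_on ler01 (smooth_weight_dominated _ cw)
    (continuous_smooth_weight cw) (leqnn r) (U := 0)) => // u _.
  rewrite /smooth_weight /knot_poly big_ord0 mulr1 mulr_gt0//.
  by rewrite /squash divr_gt0// ltr_wpDr.
pose w' u := w u * (1 - squash u).
have cw' : continuous w'.
  by move=> u; apply: cvgM; [exact: cw|apply: cvgB; [exact: cvg_cst|exact: continuous_squash]].
have w'0 u : 0 < w' u by rewrite mulr_gt0// subr_gt0 squash_lt1.
have [x [x01 [q [q0 qq Hq]]]] := IHn w' cw' w'0.
pose xi (N : nat) : R := 1 - N.+1%:R^-1.
have xi01 N : 0 <= xi N < 1.
  rewrite subr_ge0 invf_le1 ?ltr0n// ler1n /= ltrBlDl ltrDr invr_gt0 ltr0n//.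
have xi1 : xi N @[N --> \oo] --> (1 : R).
  rewrite -[X in _ --> X]subr0; apply: cvgB; first exact: cvg_cst.
  exact: cvg_harmonic.
have cv t : 0 <= t -> smooth_spline w (cons_knot (xi N) x) t @[N --> \oo] -->
    smooth_spline w' x t.
  move=> t0; apply: itail_cvg_comp => //; last exact: cvg_cst.
  - by move=> N; exact: smooth_weight_dominated.
  - exact: smooth_weight_dominated.
  - apply: aeW => u; apply: cvgMr.
    apply: (@continuous_cvg _ _ _ _ _ _ squash); first exact: continuous_squash.
    under eq_fun do rewrite knot_poly_cons mulrA.
    apply: cvgMl; apply: cvgMr; apply: cvgB => //; exact: cvg_cst.
have [N HN] : exists N, forall i : 'I_n.+1,
    0 < (-1) ^+ i * smooth_spline w (cons_knot (xi N) x) (q i).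
  have : \forall N \near \oo, forall i : 'I_n.+1,
      0 < (-1) ^+ i * smooth_spline w (cons_knot (xi N) x) (q i).
    apply: filter_forall => i.
    have := Hq _ (ltn_ord i); rewrite mul1r => Hi.
    have cvi : (-1) ^+ i * smooth_spline w (cons_knot (xi N) x) (q i)
        @[N --> \oo] --> (-1) ^+ i * smooth_spline w' x (q i).
      by apply: cvgMr; exact: cv.
    exact: (cvgr_gt _ cvi _ Hi).
  by move=> [N _ /(_ N (leqnn N))]; exists N.
exists (cons_knot (xi N) x); split.
  by move=> j; rewrite /cons_knot; case: unlift => [i|]; [exact: x01|exact: xi01].
set y := cons_knot (xi N) x.
have y01 j : 0 <= y j < 1.
  by rewrite /y /cons_knot; case: unlift => [i|]; [exact: x01|exact: xi01].
(* From [U] on every knot has been passed, so the smoothed weight has the sign [(-1) ^+ n.+1]; this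
   supplies the additional point [T]. *)
pose U := 1 + \sum_j unsquash (y j).
have U0 : 0 <= U by rewrite addr_ge0// sumr_ge0// => j _; exact: unsquash_ge0.
have yU j u : U <= u -> y j < squash u.
  move=> Uu; rewrite lt_squash ?y01//; last exact: le_trans Uu.
  apply: lt_le_trans Uu; rewrite /U (bigD1 j)//= addrCA ltrDl ltr_wpDr//.
  by apply: sumr_ge0 => i _; exact: unsquash_ge0.
pose T := Num.max (q n) U.
have ST : 0 < (-1) ^+ n.+1 * smooth_spline w y T.
  have := @itail_gt0_on r (fun u => (-1) ^+ n.+1 * smooth_weight w y u) 1 U T ler01.
  rewrite (itailZ _ W ler01 (smooth_weight_dominated y cw) (leqnn r)); apply.
  - have := dominatedZ ((-1) ^+ n.+1) (smooth_weight_dominated y cw).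
    by rewrite normrX normrN1 expr1n mulr1.
  - by move=> u; apply: cvgMr; exact: (continuous_smooth_weight cw).
  - exact: leqnn.
  - move=> u Uu; rewrite /smooth_weight mulrCA mulr_gt0// mulrA.
    apply: divr_gt0; last by rewrite ltr_wpDr.
    rewrite mulrCA mulr_gt0// /knot_poly -[X in (-1) ^+ X]card_ord -prodr_const -big_split/=.
    by apply: prodr_gt0 => j _; rewrite mulN1r opprB subr_gt0; exact: yU.
  - by rewrite le_max lexx orbT.
exists (fun i => if (i <= n)%N then q i else T); split.
- by move=> i; case: ifP => // _; rewrite le_max q0.
- move=> i; rewrite !ltnS => im; rewrite im; case: ifP => im'; first exact: qq.
  have -> : i = n by apply/eqP; rewrite eqn_leq im leqNgt im'.
  by rewrite le_max lexx.
- move=> i im; rewrite mul1r; case: ifP => im'.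
    exact: (HN (Ordinal (im' : (i < n.+1)%N))).
  have -> : i = n.+1 by apply/eqP; rewrite eqn_leq -ltnS im ltnNge im'.
  exact: ST.
Qed.

End SmoothedSign.

(** * Common convergent subsequences, and difference quotients of products *)

Section SubsequencesAndProducts.
Context {R : realType}.

Lemma bolzano_weierstrass_fin (I : finType) (u : I -> nat -> R) (C : R) :
  (forall i N, `|u i N| <= C) -> exists (f : nat -> nat) (l : I -> R),
    f N @[N --> \oo] --> \oo /\ forall i, u i (f N) @[N --> \oo] --> l i.
Proof.
move=> uC.
have H (s : seq I) : exists f : nat -> nat, (forall N, N <= f N)%N /\
    forall i, i \in s -> cvgn (u i \o f).
  elim: s => [|i s [f [fN IHs]]]; first by exists id.
  have [|g gi cvi] := @bolzano_weierstrass R (u i \o f).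
    exists C; split; first exact: num_real.
    by move=> x Cx N _; apply: (le_trans (uC i (f N))); exact: ltW.
  have gN N : (N <= g N)%N.
    elim: N => // N IHN; rewrite (leq_ltn_trans IHN)// ltnNge.
    by have := gi N.+1 N; rewrite ltnn => /negbT.
  have goo : g N @[N --> \oo] --> \oo.
    move=> A [M _ MA]; exists M => // N /= MN; apply: MA => /=.
    exact: leq_trans (gN N).
  exists (f \o g); split=> [N|j]; first by rewrite /= (leq_trans (gN N)).
  rewrite inE => /predU1P[->//|/IHs fj].
  apply/cvg_ex; exists (limn (u j \o f)).
  exact: (cvg_comp g (u j \o f) goo fj).
have [f [fN cf]] := H (enum I); exists f, (fun i => limn (u i \o f)); split.
  move=> A [M _ MA]; exists M => // N /= MN; apply: MA => /=.
  exact: leq_trans (fN N).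
by move=> i; apply: cf; rewrite mem_enum.
Qed.

(** [C] does not depend on [a], hence not on [u] when [a j] is [x j - squash u]; it provides the
    domination in [smooth_spline_diff_cvg]. *)
Lemma prod_diff_bound (I : Type) (s : seq I) (d : I -> R) :
  exists2 C : R, 0 <= C & forall (h : R) (a : I -> R), `|h| <= 1 ->
    (forall j, `|a j| <= 2) ->
    `|\prod_(j <- s) (a j + h * d j) - \prod_(j <- s) a j| <= C * `|h| /\
    `|\prod_(j <- s) (a j + h * d j)| <= C.
Proof.
elim: s => [|j s [C C0 IHs]].
  exists 1 => // h a _ _; rewrite !big_nil subrr normr0 normr1; split => //.
exists ((2 + `|d j|) * C + `|d j| * C) => [|h a h1 a2].
  by rewrite addr_ge0// mulr_ge0// addr_ge0.
have [H1 H2] := IHs h a h1 a2; rewrite !big_cons.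
set P := \prod_(j <- s) (a j + h * d j) in H1 H2 *.
set Q := \prod_(j <- s) a j in H1 H2 *.
split.
  have -> : (a j + h * d j) * P - a j * Q = a j * (P - Q) + h * d j * P by ring.
  rewrite (le_trans (ler_normD _ _))// !normrM mulrDl.
  apply: lerD.
    rewrite (le_trans (ler_wpM2l (normr_ge0 _) H1))// mulrA ler_wpM2r//.
    by rewrite ler_wpM2r// (le_trans (a2 j))// lerDl.
  rewrite -mulrA [leLHS]mulrC ler_wpM2r// ler_wpM2l//.
rewrite normrM; apply: (@le_trans _ _ ((2 + `|d j|) * C)); last first.
  by rewrite lerDl mulr_ge0.
apply: ler_pM => //; rewrite (le_trans (ler_normD _ _))// lerD// normrM.
by rewrite ler_piMl.
Qed.

Lemma prod_diff_cvg (I : eqType) (s : seq I) (a d : I -> R) (h : nat -> R) : uniq s ->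
  (forall N, h N != 0) -> h N @[N --> \oo] --> (0 : R) ->
  (\prod_(j <- s) (a j + h N * d j) - \prod_(j <- s) a j) / h N @[N --> \oo] -->
  \sum_(j <- s) d j * \prod_(l <- s | l != j) a l.
Proof.
move=> us hn0 h0; elim: s us => [|j s IHs] /=.
  by move=> _; rewrite !big_nil; under eq_fun do rewrite !big_nil subrr mul0r; exact: cvg_cst.
move=> /andP[js /IHs{}IHs].
have -> : \sum_(i <- j :: s) d i * \prod_(l <- j :: s | l != i) a l =
    a j * (\sum_(i <- s) d i * \prod_(l <- s | l != i) a l) + d j * \prod_(l <- s) a l.
  rewrite big_cons addrC; congr (_ + _).
    rewrite big_distrr/= !big_seq; apply: eq_bigr => i si.
    rewrite big_cons; case: eqP => [ij|_]; first by rewrite ij si in js.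
    by rewrite mulrCA.
  congr (_ * _); rewrite big_cons eqxx/= big_seq_cond [RHS]big_seq.
  apply: eq_bigl => i; case: (boolP (i \in s)) => //= si.
  by apply: contraNneq js => <-.
have Hp : \prod_(i <- s) (a i + h N * d i) @[N --> \oo] --> \prod_(i <- s) a i.
  apply: cvgr_prod => i; rewrite -[X in _ --> X]addr0; apply: cvgD; first exact: cvg_cst.
  by rewrite -(mul0r (d i)); apply: cvgMl.
have -> : (fun N => (\prod_(i <- j :: s) (a i + h N * d i) - \prod_(i <- j :: s) a i) / h N) =
   fun N => a j * ((\prod_(i <- s) (a i + h N * d i) - \prod_(i <- s) a i) / h N) +
      d j * \prod_(i <- s) (a i + h N * d i).
  by apply/funext => N; rewrite !big_cons; field; exact: hn0.
by apply: cvgD; apply: cvgMr.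
Qed.

End SubsequencesAndProducts.

(** * Derivatives in the knots, and interpolation by them *)

Section SmoothedSolution.
Context {R : realType}.

Lemma positive_lower_bound (a : nat -> R) n : (forall i, (i <= n)%N -> 0 < a i) ->
  exists2 c : R, 0 < c & forall i, (i <= n)%N -> c <= a i.
Proof.
elim: n => [|n IHn] H.
  by exists (a 0%N); [exact: H|move=> i; rewrite leqn0 => /eqP ->].
have [i im|c c0 Hc] := IHn; first by apply: H; exact: leqW.
exists (Num.min c (a n.+1)); first by rewrite lt_min c0 H.
move=> i; rewrite leq_eqVlt => /predU1P[->|im]; first by rewrite ge_min lexx orbT.
by rewrite ge_min Hc.
Qed.

Lemma increasing_lt (q : nat -> R) n : (forall i, (i.+1 < n)%N -> q i < q i.+1) ->
  forall i j, (i < j < n)%N -> q i < q j.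
Proof.
move=> H i j; elim: j => // j IHj /andP[]; rewrite ltnS leq_eqVlt => /predU1P[->|ij] jn.
  exact: H.
by apply: (lt_trans (IHj _)); [rewrite ij ltnW|exact: H].
Qed.

Variables (r : nat) (k : R -> R).
Hypotheses (W : weight r k) (r0 : (0 < r)%N).

Lemma dominatedD c c' f f' : dominated k c f -> dominated k c' f' ->
  dominated k (c + c') (fun x => f x + f' x).
Proof.
move=> [mf fk] [mf' fk']; split; first exact: measurable_funD.
by move=> x; rewrite (le_trans (ler_normD _ _))// mulrDl lerD.
Qed.

Lemma itailD c c' f f' m : 0 <= c -> 0 <= c' ->
  dominated k c f -> dominated k c' f' -> (m <= r)%N ->
  itail m (fun x => f x + f' x) = fun x => itail m f x + itail m f' x.
Proof.
move=> c0 c'0 df df' mr.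
have -> : (fun x => f x + f' x) = fun x => f x - -1 * f' x.
  by apply/funext => x; rewrite mulN1r opprK.
have d' := dominatedZ (-1) df'.
rewrite (itailB W c0 _ df d' mr) ?mulr_ge0// (itailZ _ W c'0 df' mr).
by apply/funext => x; rewrite mulN1r opprK.
Qed.

Lemma itail_sum (I : Type) (s : seq I) c (a : I -> R) (f : I -> R -> R) m :
  0 <= c -> (forall j, dominated k c (f j)) -> (m <= r)%N ->
  dominated k (\sum_(j <- s) `|a j| * c) (fun u => \sum_(j <- s) a j * f j u) /\
  itail m (fun u => \sum_(j <- s) a j * f j u) =
  fun t => \sum_(j <- s) a j * itail m (f j) t.
Proof.
have [_ k0 _ _] := W; move=> c0 df mr; elim: s => [|j s [IHd IHs]].
  rewrite big_nil; split.
    split; last by move=> x; rewrite big_nil normr0 mul0r.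
    by under eq_fun do rewrite big_nil; exact: measurable_cst.
  have E := itailZ 0 W ler01 (weight_dominated W) mr.
  have -> : (fun u => \sum_(j <- [::]) a j * f j u) = fun x => 0 * k x.
    by apply/funext => u; rewrite big_nil mul0r.
  by rewrite E; apply/funext => t; rewrite mul0r big_nil.
have E u : \sum_(i <- j :: s) a i * f i u = a j * f j u + \sum_(i <- s) a i * f i u.
  by rewrite big_cons.
rewrite big_cons (funext E); have d1 := dominatedZ (a j) (df j); split.
  exact: dominatedD.
rewrite (itailD _ _ d1 IHd mr); first last.
- by apply: sumr_ge0 => i _; rewrite mulr_ge0.
- by rewrite mulr_ge0.
rewrite (itailZ _ W c0 (df j) mr) IHs.
by apply/funext => t; rewrite big_cons.
Qed.

Section Perturbation.
Variables (n : nat) (w : R -> R) (Cw : R) (x : 'I_n -> R).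
Hypotheses (cw : continuous w) (w0 : forall u, 0 < w u) (wC : forall u, w u <= Cw).
Hypothesis x01 : forall j, 0 <= x j <= 1.

(** The partial derivative of [smooth_weight k w x u] in the knot [x j]. *)
Definition weight_deriv (j : 'I_n) u := k u * ((w u * \prod_(l < n | l != j) (x l - squash u))
  / (1 + `|w u * knot_poly x u|) ^+ 2).

Let Cw0 : 0 <= Cw.
Proof. by rewrite (le_trans _ (wC 0))// ltW. Qed.

Let den_gt0 u : 0 < (1 + `|w u * knot_poly x u|) ^+ 2.
Proof. by rewrite exprn_gt0// ltr_wpDr. Qed.

Lemma factor_norm j u : `|x j - squash u| <= 2.
Proof.
have /andP[H1 H2] := x01 j; rewrite (le_trans (ler_normB _ _))// -[2]/(1 + 1) lerD//.
  by rewrite ger0_norm.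
exact: squash_norm.
Qed.

Lemma continuous_weight_deriv j : continuous (weight_deriv j).
Proof.
have [ck _ _ _] := W.
move=> u; apply: cvgM; first exact: ck.
apply: cvgM.
  apply: cvgM; first exact: cw.
  under eq_fun do rewrite -big_filter; rewrite -big_filter.
  apply: cvgr_prod => l; apply: cvgB; first exact: cvg_cst.
  exact: continuous_squash.
apply: cvgV; first by rewrite gt_eqF.
rewrite expr2; under eq_fun do rewrite expr2.
have H : 1 + `|w u0 * knot_poly x u0| @[u0 --> u] --> 1 + `|w u * knot_poly x u|.
  apply: cvgD; first exact: cvg_cst.
  by apply: cvg_norm; apply: cvgM; [exact: cw|exact: continuous_knot_poly].
exact: cvgM.
Qed.

Lemma weight_deriv_dominated j : dominated k (Cw * 2 ^+ n) (weight_deriv j).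
Proof.
have [_ k0 _ _] := W; split.
  by apply: continuous_measurable_fun; exact: continuous_weight_deriv.
move=> u; rewrite normrM (gtr0_norm (k0 u)) mulrC ler_pM2r//.
rewrite normrM normfV (gtr0_norm (den_gt0 u)) ler_pdivrMr//.
apply: (@le_trans _ _ (Cw * 2 ^+ n)); last first.
  rewrite ler_peMr ?mulr_ge0 ?exprn_ge0//.
  by rewrite -[leLHS](expr1n _ 2) lerXn2r ?nnegrE ?addr_ge0// lerDl.
rewrite normrM (gtr0_norm (w0 u)); apply: ler_pM => //; first exact: ltW.
rewrite normr_prod big_mkcond/=.
rewrite -[X in 2 ^+ X]card_ord -prodr_const; apply: ler_prod => l _.
case: ifP => _; last by rewrite ler01 ler1n.
by rewrite normr_ge0 factor_norm.
Qed.

Lemma sum_weight_derivE (d : 'I_n -> R) u :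
  \sum_(j < n) d j * weight_deriv j u = k u * ((w u *
    \sum_(j < n) d j * \prod_(l < n | l != j) (x l - squash u)) /
    (1 + `|w u * knot_poly x u|) ^+ 2).
Proof.
rewrite big_distrr big_distrl big_distrr/=; apply: eq_bigr => j _.
by rewrite /weight_deriv; ring.
Qed.

Lemma smooth_spline_diff_cvg (d : 'I_n -> R) t :
  (smooth_spline r k w (fun j => x j + N.+1%:R^-1 * d j) t - smooth_spline r k w x t)
    / N.+1%:R^-1 @[N --> \oo] --> \sum_(j < n) d j * itail r (weight_deriv j) t.
Proof.
have [_ k0 _ _] := W.
pose h (N : nat) : R := N.+1%:R^-1.
have h0 N : 0 < h N by rewrite invr_gt0 ltr0n.
have h1 N : `|h N| <= 1 by rewrite gtr0_norm// invf_le1 ?ltr0n// ler1n.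
pose c := Cw * 2 ^+ n.
have c0 : 0 <= c by rewrite mulr_ge0// exprn_ge0.
have [dz Ez] := itail_sum (index_enum _) d c0 weight_deriv_dominated (leqnn r).
have -> : \sum_(j < n) d j * itail r (weight_deriv j) t =
    itail r (fun u => \sum_(j < n) d j * weight_deriv j u) t by rewrite Ez.
pose fN N := smooth_weight k w (fun j => x j + h N * d j).
have dfN N : dominated k 1 (fN N) by exact: (smooth_weight_dominated W _ cw).
have df : dominated k 1 (smooth_weight k w x) by exact: (smooth_weight_dominated W _ cw).
have [C C0 HC] := prod_diff_bound (index_enum 'I_n) d.
pose D N u := (h N)^-1 * (fN N u - smooth_weight k w x u).
have -> : (fun N => (smooth_spline r k w (fun j => x j + N.+1%:R^-1 * d j) t -
    smooth_spline r k w x t) / N.+1%:R^-1) = fun N => itail r (D N) t.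
  apply/funext => N; rewrite /D.
  rewrite (itailZ _ W _ (dominatedB (dfN N) df) (leqnn r)) ?addr_ge0//.
  by rewrite (itailB W ler01 ler01 (dfN N) df (leqnn r)) mulrC.
(* A single constant has to dominate both the difference quotients (first term) and their limit
   (second term). *)
pose c' := Num.max (Cw * C) (\sum_(j < n) `|d j| * c).
have c'0 : 0 <= c' by rewrite le_max mulr_ge0.
have rr : (0 < r <= r)%N by rewrite r0 leqnn.
apply: (itail_dominated_cvg W c'0) rr.
- move=> N; split.
    apply: measurable_funM => //; apply: measurable_funB; first by have [] := dfN N.
    by have [] := df.
  move=> u; rewrite /D normrM normfV (gtr0_norm (h0 N)) mulrC ler_pdivrMr//.
  rewrite /fN /smooth_weight -mulrBr normrM (gtr0_norm (k0 u)).
  rewrite mulrC -mulrA mulrCA [leRHS]mulrC ler_wpM2r ?(ltW (k0 u))//.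
  rewrite (le_trans (squash_lipschitz _ _))// -mulrBr normrM (gtr0_norm (w0 u)).
  have [H _] := HC (h N) (fun j => x j - squash u) (h1 N) (fun j => factor_norm j u).
  have {}H : `|knot_poly (fun j => x j + h N * d j) u - knot_poly x u| <= C * h N.
    rewrite -[in leRHS](gtr0_norm (h0 N)) /knot_poly; apply: le_trans H.
    by under [in leLHS]eq_bigr do rewrite addrAC.
  apply: (@le_trans _ _ (Cw * (C * h N))); first by rewrite ler_pM// ltW.
  by rewrite mulrA ler_wpM2r ?(ltW (h0 N))// le_max lexx.
- have [md dd] := dz; split => // u; apply: (le_trans (dd u)).
  by rewrite ler_wpM2r ?(ltW (k0 u))// le_max lexx orbT.
- apply: aeW => u.
  rewrite sum_weight_derivE.
  have -> : D ^~ u = fun N => k u * ((squash (w u * knot_poly (fun j => x j + h N * d j) u)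
      - squash (w u * knot_poly x u)) / h N).
    by apply/funext => N; rewrite /D /fN /smooth_weight; ring.
  have hz : h N @[N --> \oo] --> (0 : R) by exact: cvg_harmonic.
  apply: cvgMr; apply: squash_diff_cvg.
    apply: cvgMr; apply: cvgr_prod => j; apply: cvgB; last exact: cvg_cst.
    rewrite -[X in _ --> X]addr0; apply: cvgD; first exact: cvg_cst.
    by rewrite -(mul0r (d j)); apply: cvgMl.
  have -> : (fun N => (w u * knot_poly (fun j => x j + h N * d j) u -
      w u * knot_poly x u) / h N) = fun N => w u *
      ((\prod_(j < n) ((x j - squash u) + h N * d j) - \prod_(j < n) (x j - squash u)) / h N).
    apply/funext => N; rewrite -mulrBr mulrA /knot_poly; congr (_ * (_ - _) / _).
    by apply: eq_bigr => j _; rewrite addrAC.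
  apply: cvgMr; apply: prod_diff_cvg => //; first exact: index_enum_uniq.
  by move=> N; rewrite gt_eqF.
Qed.

(** If a combination of the columns of values vanishes at the [n] points, Rolle gives [n] zeros of
    the combination [Z] of the [weight_deriv j]. Up to a positive factor [Z] is, for one global
    sign, the polynomial [Q] in [squash u], of degree below [n]; so [Q = 0], and its coefficients
    vanish because the products in it form a Lagrange basis at the distinct knots. *)
Lemma smooth_spline_interpolation (q : nat -> R) (e : 'I_n -> R) : injective x ->
  (forall i, 0 <= q i) -> (forall i, (i.+1 < n)%N -> q i < q i.+1) ->
  exists d : 'I_n -> R, forall i : 'I_n,
    \sum_(j < n) d j * itail r (weight_deriv j) (q i) = e i.
Proof.
have [_ k0 _ _] := W; move=> xinj q0 qq.
pose B : 'M[R]_n := \matrix_(j, i) itail r (weight_deriv j) (q i).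
have c0 : 0 <= Cw * 2 ^+ n by rewrite mulr_ge0// exprn_ge0.
have BU : B \in unitmx.
  rewrite -row_free_unit; apply: inj_row_free => v vB.
  have [dz Ez] := itail_sum (index_enum _) (fun j => v 0 j) c0 weight_deriv_dominated (leqnn r).
  pose Z u := \sum_(j < n) v 0 j * weight_deriv j u.
  have cZ : continuous Z.
    move=> u; apply: (cvg_big (op := +%R)); first exact: add_continuous.
    by move=> j _; apply: cvgMr; exact: continuous_weight_deriv.
  have : has_zeros (itail r Z) n.
    exists q; split => // i im; rewrite Ez.
    move/matrixP : vB => /(_ 0 (Ordinal im)); rewrite !mxE => E.
    by rewrite -[RHS]E; apply: eq_bigr => j _; rewrite mxE.
  move=> /(has_zeros_itail W _ dz cZ (leqnn r)); case.
    by apply: sumr_ge0 => j _; rewrite mulr_ge0.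
  move=> z [z0 zz Hz].
  pose Q : {poly R} := \sum_(j < n) v 0 j *: \prod_(l < n | l != j) ('X - (x l)%:P).
  have QE y : Q.[y] = \sum_(j < n) v 0 j * \prod_(l < n | l != j) (y - x l).
    rewrite horner_sum; apply: eq_bigr => j _; rewrite hornerZ horner_prod.
    by congr (_ * _); apply: eq_bigr => l _; rewrite !hornerE.
  have sQ : (size Q <= n)%N.
    apply: (leq_trans (size_sum _ _ _)); apply/bigmax_leqP => j _.
    apply: (leq_trans (size_scale_leq _ _)).
    rewrite -big_filter size_prod_XsubC size_filter.
    have -> : count (fun l => l != j) (index_enum 'I_n) = #|predC1 j|.
      by rewrite -sum1_count -sum1_card; apply: eq_bigl.
    by rewrite cardC1 card_ord (ltn_predK (ltn_ord j)).
  have rootQ i : (i < n)%N -> root Q (squash (z i)).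
    move=> im; have := Hz _ im; rewrite /Z sum_weight_derivE => /eqP.
    rewrite mulf_eq0 (gt_eqF (k0 _))/= mulf_eq0 invr_eq0 (gt_eqF (den_gt0 _)) orbF.
    rewrite mulf_eq0 (gt_eqF (w0 _))/= => /eqP S0.
    apply/rootP; rewrite QE; transitivity ((-1) ^+ n.-1 *
      \sum_(j < n) v 0 j * \prod_(l < n | l != j) (x l - squash (z i))); last first.
      by rewrite S0 mulr0.
    rewrite big_distrr/=.
    apply: eq_bigr => j _; rewrite mulrCA; congr (_ * _).
    have -> : (-1) ^+ n.-1 = \prod_(l < n | l != j) (-1 : R).
      by rewrite -[n in LHS]card_ord -(cardC1 j) -prodr_const; apply: eq_bigl.
    by rewrite -big_split/=; apply: eq_bigr => l _; rewrite mulN1r opprB.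
  have Q0 : Q = 0.
    apply: (@roots_geq_poly_eq0 _ Q [seq squash (z i) | i <- iota 0 n]).
    - apply/allP => y /mapP[i]; rewrite mem_iota => /= im ->; exact: rootQ.
    - rewrite map_inj_in_uniq ?iota_uniq// => i j; rewrite !mem_iota/= !add0n => im jm.
      move=> E; apply/eqP; rewrite eqn_leq; apply/andP; split; rewrite leqNgt; apply/negP => ij.
        have /(squash_lt (z0 j)) : z j < z i by apply: (increasing_lt zz); rewrite ij.
        by rewrite E ltxx.
      have /(squash_lt (z0 i)) : z i < z j by apply: (increasing_lt zz); rewrite ij.
      by rewrite E ltxx.
    - by rewrite size_map size_iota.
  apply/rowP => j; rewrite mxE.
  have : Q.[x j] = 0 by rewrite Q0 horner0.
  rewrite QE (bigD1 j)//= [X in _ + X]big1 ?addr0 => [|i ij]; last first.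
    by rewrite (bigD1 j) 1?eq_sym//= subrr mul0r mulr0.
  move=> /eqP; rewrite mulf_eq0 => /orP[/eqP //|/prodf_eq0[l lj]].
  by rewrite subr_eq0 => /eqP /xinj E; rewrite E eqxx in lj.
exists (fun j => ((\row_i e i) *m invmx B) 0 j) => i.
have : ((\row_i e i) *m invmx B *m B) 0 i = e i by rewrite mulmxKV// mxE.
rewrite mxE => <-; by apply: eq_bigr => j _; rewrite [B j i]mxE.
Qed.

End Perturbation.
End SmoothedSolution.

(** * Maximal amplitude on a compact interval, and the exchange of points *)

Section Exchange.
Context {R : realType}.
Variables (r : nat) (k : R -> R).
Hypotheses (W : weight r k) (r0 : (0 < r)%N).
Variables (n : nat) (w : R -> R) (Cw : R).
Hypotheses (cw : continuous w) (w0 : forall u, 0 < w u) (wC : forall u, w u <= Cw).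
Variables (F : bool -> R -> R) (m X : R).
Hypotheses (cF : forall b, continuous (F b)) (m0 : 0 < m) (Fm : forall b t, m <= F b t).

Let S (x : 'I_n -> R) := smooth_spline r k w x.

(** [F false] and [F true] are the upper and lower widths of the tube. All conditions are weak
    inequalities and the knots may reach 0 and 1, so that feasibility passes to limits. *)
Definition feasible (x : 'I_n -> R) (p : nat -> R) (tau : R) :=
  [/\ forall j, 0 <= x j <= 1, forall i, 0 <= p i <= X,
      forall i, (i < n)%N -> p i <= p i.+1 &
      forall i, (i <= n)%N -> tau * F (odd i) (p i) <= (-1) ^+ i * S x (p i)].

Let F0 b t : 0 < F b t.
Proof. exact: lt_le_trans (Fm b t). Qed.

Lemma feasible_bound x p tau : feasible x p tau -> 0 < tau -> tau <= itail r k 0 / m.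
Proof.
move=> [_ pX _ /(_ 0%N (leq0n n))]; rewrite expr0 mul1r => H t0.
rewrite ler_pdivlMr//; apply: (le_trans (ler_wpM2l (ltW t0) (Fm (odd 0) (p 0%N)))).
apply: (le_trans H); apply: (le_trans (ler_norm _)).
apply: (le_trans (smooth_spline_norm W _ _ cw)).
by apply: (itail_nincr W (leqnn r)); have /andP[] := pX 0%N.
Qed.

Lemma feasible_closed (x_ : nat -> 'I_n -> R) (p_ : nat -> nat -> R) (tau_ : nat -> R)
    (tau : R) : (forall N, feasible (x_ N) (p_ N) (tau_ N)) ->
  tau_ N @[N --> \oo] --> tau -> exists x p, feasible x p tau.
Proof.
move=> fN tt.
pose u (i : 'I_n + 'I_n.+1) N := match i with inl j => x_ N j | inr i => p_ N i end.
have [i N|f [l [foo fl]]] := @bolzano_weierstrass_fin R _ u (Num.max 1 X).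
  have [x01 pX _ _] := fN N; rewrite le_max; case: i => i /=.
    by have /andP[? ?] := x01 i; rewrite ger0_norm//; apply/orP; left.
  by have /andP[? ?] := pX i; rewrite ger0_norm//; apply/orP; right.
(* [inord] extends the limit to all indices in a way that keeps every [p i] in [[0, X]]. *)
pose x j := l (inl j); pose p i := l (inr (inord i)).
have xl j : x_ (f N) j @[N --> \oo] --> x j by exact: (fl (inl j)).
have pl i : p_ (f N) (inord i : 'I_n.+1) @[N --> \oo] --> p i by exact: (fl (inr (inord i))).
have x01 j : 0 <= x j <= 1.
  apply/andP; split; [apply: (cvgr_to_ge (xl j))|apply: (cvgr_to_le (xl j))];
    by apply: nearW => N; have [/(_ j)/andP[]] := fN (f N).
have pX i : 0 <= p i <= X.
  apply/andP; split; [apply: (cvgr_to_ge (pl i))|apply: (cvgr_to_le (pl i))];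
    by apply: nearW => N; have [_ /(_ (inord i : 'I_n.+1))/andP[]] := fN (f N).
exists x, p; split => // i im.
  apply: (ler_cvg_to (pl i) (pl i.+1)); apply: nearW => N.
  have [_ _ pp _] := fN (f N); rewrite !inordK ?ltnS//; first exact: pp.
  exact: ltnW.
have Fl : tau_ (f N) * F (odd i) (p_ (f N) (inord i : 'I_n.+1)) @[N --> \oo] -->
    tau * F (odd i) (p i).
  apply: cvgM; first exact: (cvg_comp _ _ foo tt).
  by apply: (@continuous_cvg _ _ _ _ _ _ (F (odd i))); [exact: cF|exact: pl].
have Sl : (-1) ^+ i * S (x_ (f N)) (p_ (f N) (inord i : 'I_n.+1)) @[N --> \oo] -->
    (-1) ^+ i * S x (p i).
  apply: cvgMr; apply: (itail_cvg_comp W r0) => //.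
  - by move=> N; exact: (smooth_weight_dominated W _ cw).
  - exact: (smooth_weight_dominated W _ cw).
  - by apply: aeW => y; exact: smooth_weight_cvg.
  - by move=> N; have [_ /(_ (inord i : 'I_n.+1))/andP[]] := fN (f N).
  - by have /andP[] := pX i.
apply: (ler_cvg_to Fl Sl); apply: nearW => N.
by have [_ _ _ /(_ _ im)] := fN (f N); rewrite inordK.
Qed.

Lemma feasible_max x0 p0 tau0 : 0 < tau0 -> feasible x0 p0 tau0 ->
  exists x p tau, [/\ tau0 <= tau, feasible x p tau &
    forall x' p' tau', feasible x' p' tau' -> tau' <= tau].
Proof.
move=> t0 f0; pose E := [set t : R | exists x p, feasible x p t].
have E0 : E tau0 by exists x0, p0.
have Eb : ubound E (Num.max 0 (itail r k 0 / m)).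
  move=> t [x [p fe]]; rewrite le_max; have [//|t0'] := leP t 0.
  by rewrite (feasible_bound fe t0').
have hE : has_sup E by split; [exists tau0|exists (Num.max 0 (itail r k 0 / m))].
have /choice[t_ Ht] : forall N : nat, exists t, E t /\ sup E - N.+1%:R^-1 < t.
  move=> N; have N0 : 0 < (N.+1%:R^-1 : R) by rewrite invr_gt0 ltr0n.
  by have [t Et lt] := sup_adherent N0 hE; exists t.
have /choice[x_ /choice[p_ Hp]] : forall N, exists x p, feasible x p (t_ N).
  by move=> N; have [] := Ht N.
have ts : t_ N @[N --> \oo] --> sup E.
  have lo : sup E - N.+1%:R^-1 @[N --> \oo] --> sup E.
    rewrite -[X in _ --> X]subr0; apply: cvgB; first exact: cvg_cst.
    exact: cvg_harmonic.
  apply: (squeeze_cvgr _ lo (cvg_cst (sup E))); apply: nearW => N.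
  have [Et /ltW ->/=] := Ht N; by apply: sup_upper_bound.
have [x [p fe]] := feasible_closed Hp ts.
exists x, p, (sup E); split => //; first by apply: sup_upper_bound.
by move=> x' p' t' fe'; apply: (sup_upper_bound hE); exists x', p'.
Qed.

Definition replace_point (p : nat -> R) (l : nat) (q : R) i := if i == l then q else p i.

(** As in the Remez exchange: a new point replaces a neighbour with the same sign, unless it lies
    outside all the points and has the sign opposite to the nearest; then it prolongs the
    alternation, to the left with first sign -1 or to the right with first sign 1. *)
Lemma exchange_point (G : R -> R) (p : nat -> R) (q : R) (b : bool) :
  (forall i, 0 <= p i) -> 0 <= q -> (forall i, (i < n)%N -> p i <= p i.+1) ->
  (forall i, (i <= n)%N -> 0 < (-1) ^+ i * G (p i)) -> 0 < (-1) ^+ b * G q ->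
  alternates G n.+2 1 \/ alternates G n.+2 (-1) \/
  exists l, [/\ (l <= n)%N, odd l = b &
    forall i, (i < n)%N -> replace_point p l q i <= replace_point p l q i.+1].
Proof.
move=> p0 q0 pp Gp Gq.
(* [a] will be the index of the first point beyond [q], or [n + 1] if there is none. *)
have exa : exists a, (a == n.+1) || (q < p a) by exists n.+1; rewrite eqxx.
have [a Ha mina] := ex_minnP exa.
have an : (a <= n.+1)%N by apply: mina; rewrite eqxx.
have pq i : (i < a)%N -> p i <= q.
  move=> ia; rewrite leNgt; apply/negP => qpi.
  by have := mina i; rewrite qpi orbT => /(_ isT); rewrite leqNgt ia.
have qpa : (a <= n)%N -> q < p a.
  by move=> a_n; move: Ha; rewrite eqn_leq ltnNge andbC a_n.
have Gq' (c : nat) : odd c = b -> 0 < (-1) ^+ c * G q by rewrite -signr_odd => ->.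
have repl l : (l <= n)%N -> odd l = b -> ((l < a)%N -> (l.+1 <= n)%N -> q <= p l.+1) ->
    (forall i, i.+1 = l -> p i <= q) -> (l < a \/ l = a)%N -> exists l, [/\ (l <= n)%N, odd l = b &
    forall i, (i < n)%N -> replace_point p l q i <= replace_point p l q i.+1].
  move=> ln lb H1 H2 H3; exists l; split => // i im; rewrite /replace_point.
  have [il|il] := eqVneq i l.
    rewrite il -{2}[l]addn0 -addn1 eqn_add2l/= addn1.
    case: H3 => [la|la]; first by apply: H1 => //; rewrite -il.
    by rewrite (le_trans _ (pp _ _)) -?il//; apply/ltW; rewrite il la; apply: qpa; rewrite -la.
  have [il'|il'] := eqVneq i.+1 l; [exact: H2|exact: pp].
case: a Ha mina an pq qpa repl => [|a] Ha mina an pq qpa repl.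
  have qp := qpa isT; case: b Gq Gq' repl => Gq Gq' repl; last first.
    by right; right; apply: (repl 0%N) => //; right.
  right; left; exists (fun i => if i is i'.+1 then p i' else q); split.
  - by case.
  - move=> [|i]; first by move=> _; exact: ltW.
    by rewrite ltnS => im; apply: pp; rewrite -ltnS.
  - move=> [|i] im; first by rewrite expr0 mulr1; exact: Gq.
    by rewrite -exprS exprS exprS mulN1r mulN1r opprK; apply: Gp; rewrite -ltnS -ltnS.
have pa_q : p a <= q by exact: pq.
have a_n : (a <= n)%N by rewrite -ltnS.
have [ab|ab] := eqVneq (odd a) b.
  right; right; apply: (repl a) => //.
  - by move=> _ a1n; apply: ltW; exact: qpa.
  - by move=> i ia; apply: pq; rewrite -ia; exact: leqW.
  - by left.
have a1b : odd a.+1 = b by move: ab => /=; case: (odd a); case: (b).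
have [a1n|a1n] := leqP a.+1 n.
  right; right; apply: (repl a.+1) => //; first by rewrite ltnn.
    by move=> i [->].
  by right.
have {a1n an}E : a = n by apply/eqP; rewrite eqn_leq a_n -ltnS.
left; exists (fun i => if (i <= n)%N then p i else q); split.
- by move=> i; case: ifP.
- move=> i; rewrite !ltnS => im; rewrite im; case: ifP => im'; first exact: pp.
  have -> : i = n by apply/eqP; rewrite eqn_leq im leqNgt im'.
  by rewrite -E.
- move=> i im; rewrite mul1r; case: ifP => im'; first exact: Gp.
  have -> : i = n.+1 by apply/eqP; rewrite eqn_leq -ltnS im ltnNge im'.
  by apply: Gq'; rewrite -E.
Qed.

End Exchange.

(** * Equioscillation of smoothed splines on a compact interval *)

Section SmoothedEquioscillation.
Context {R : realType}.
Variables (r : nat) (k : R -> R).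
Hypotheses (W : weight r k) (r0 : (0 < r)%N).
Variables (n : nat) (w : R -> R) (Cw : R).
Hypotheses (cw : continuous w) (w0 : forall u, 0 < w u) (wC : forall u, w u <= Cw).
Variables (F : bool -> R -> R) (m : R).
Hypotheses (cF : forall b, continuous (F b)) (m0 : 0 < m) (Fm : forall b t, m <= F b t).

Let S (x : 'I_n -> R) := smooth_spline r k w x.

Let F0 b t : 0 < F b t.
Proof. exact: lt_le_trans (Fm b t). Qed.

Lemma feasible_exists (X0 : R) : exists X (x : 'I_n -> R) p tau,
  [/\ X0 <= X, 0 < tau & feasible r k w F X x p tau].
Proof.
have [x [x01 [q [q0 qq Hq]]]] := smooth_spline_alternates W r0 n cw w0.
pose a i := (-1) ^+ i * S x (q i) / F (odd i) (q i).
have [i im|c c0 Hc] := @positive_lower_bound R a n.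
  by rewrite divr_gt0//; have := Hq _ im; rewrite mul1r.
have qn i : (i <= n)%N -> q i <= q n.
  move=> im; rewrite -(subKn im); elim: (n - i)%N (leq_subr i n) => [|d IHd] dn.
    by rewrite subn0.
  apply: le_trans (IHd (ltnW dn)).
  have E : (n - d = (n - d.+1).+1)%N by rewrite subnSK.
  by rewrite E; apply: qq; rewrite ltnS -E leq_subr.
exists (Num.max X0 (q n)), x, (fun i => if (i <= n)%N then q i else q n), c; split => //.
  by rewrite le_max lexx.
split.
- by move=> j; have /andP[-> /ltW] := x01 j.
- move=> i; rewrite le_max; case: ifP => im; rewrite q0/=; apply/orP; right => //.
  exact: qn.
- by move=> i im; rewrite im (ltnW im); exact: qq.
- move=> i im; rewrite im; have := Hc _ im; rewrite /a ler_pdivlMr//.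
Qed.

Lemma feasible_alternates X (x : 'I_n -> R) p tau : 0 < tau -> feasible r k w F X x p tau ->
  alternates (S x) n.+1 1.
Proof.
move=> t0 [_ pX pp Hp]; exists p; split => [i|i|i im]; first by have /andP[] := pX i.
  by rewrite ltnS; exact: pp.
by rewrite mul1r (lt_le_trans _ (Hp _ im))// mulr_gt0.
Qed.

(* A point where one of the oscillations exceeds [tau] leaves [n] active points, and the
   [n] knots can be moved so that all of these increase. *)
Lemma feasible_improve X (x : 'I_n -> R) p tau l : 0 < tau -> feasible r k w F X x p tau ->
  (l <= n)%N -> tau * F (odd l) (p l) < (-1) ^+ l * S x (p l) ->
  exists (x' : 'I_n -> R) tau', tau < tau' /\ feasible r k w F X x' p tau'.
Proof.
move=> t0 fe ln Hl; have [x01 pX pp Hp] := fe.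
have [_ /(_ erefl)[x01' xinj]] := @alternates_smooth_spline _ _ _ W w n x n.+1 false cw w0
  (feasible_alternates t0 fe).
have p0 i : 0 <= p i by have /andP[] := pX i.
have plt i : (i.+1 < n.+1)%N -> p i < p i.+1.
  rewrite ltnS => im; rewrite lt_neqAle pp// andbT; apply/eqP => E.
  have := Hp i (ltnW im); have := Hp i.+1 im; rewrite E exprS mulN1r mulNr => H1 H2.
  have : 0 < tau * F (odd i) (p i.+1) by rewrite mulr_gt0.
  have : 0 < tau * F (odd i.+1) (p i.+1) by rewrite mulr_gt0.
  lra.
have bumpn i : (i < n)%N -> (bump l i <= n)%N.
  by move=> im; rewrite /bump; case: (l <= i)%N; [exact: im|exact: ltnW].
(* The data prescribe unit growth of each signed oscillation with index other than [l]; the distinct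
   knots found above make this solvable, and their being interior lets them move both ways. *)
have [] := @smooth_spline_interpolation _ _ _ W n w Cw x cw w0 wC x01
  (fun i => p (bump l i)) (fun i => (-1) ^+ (bump l i)) xinj.
- by move=> i; exact: p0.
- move=> i im; apply: (increasing_lt plt); rewrite ltnS bumpn// andbT /bump.
  by case: (leqP l i) => [li|il]; [rewrite leqW|case: (leqP l i.+1)] => //; rewrite ?leqW// !add0n.
move=> d Hd.
pose y (N : nat) j := x j + N.+1%:R^-1 * d j.
have h0 : N.+1%:R^-1 @[N --> \oo] --> (0 : R) by exact: cvg_harmonic.
have yx j : y N j @[N --> \oo] --> x j.
  rewrite -[X in _ --> X]addr0; apply: cvgD; first exact: cvg_cst.
  by rewrite -(mul0r (d j)); apply: cvgMl.
have N1 : \forall N \near \oo, forall j, 0 <= y N j <= 1.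
  apply: filter_forall => j; have /andP[xj0 xj1] := x01' j.
  by near=> N; apply/andP; split; apply/ltW; near: N;
    [exact: (cvgr_gt _ (yx j) _ xj0)|exact: (cvgr_lt _ (yx j) _ xj1)].
have N2 : \forall N \near \oo, forall i : 'I_n.+1,
    tau * F (odd i) (p i) < (-1) ^+ i * S (y N) (p i).
  apply: filter_forall => i; have [il|il] := eqVneq (nat_of_ord i) l.
    rewrite il; have cv : (-1) ^+ l * S (y N) (p l) @[N --> \oo] --> (-1) ^+ l * S x (p l).
      apply: cvgMr; apply: (itail_cvg_comp W r0) => //; last exact: cvg_cst.
      - by move=> N; exact: (smooth_weight_dominated W _ cw).
      - exact: (smooth_weight_dominated W _ cw).
      - by apply: aeW => u; exact: smooth_weight_cvg.
    exact: (cvgr_gt _ cv _ Hl).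
  have ui : (unbump l i < n)%N.
    have i_n : (i <= n)%N by rewrite -ltnS.
    have [li|il'] := ltnP l i; first by rewrite /unbump li subn1 (leq_trans _ i_n)// (ltn_predK li).
    by rewrite /unbump (ltnNge l) il' subn0 (leq_trans _ ln)// ltn_neqAle il il'.
  have bi : bump l (unbump l i) = i by rewrite unbumpK.
  have := smooth_spline_diff_cvg (d := d) (t := p i) W r0 cw w0 wC x01.
  have := Hd (Ordinal ui); rewrite /= bi => -> cv.
  have {}cv : (-1) ^+ i * ((S (y N) (p i) - S x (p i)) / N.+1%:R^-1) @[N --> \oo] --> (1 : R).
    rewrite -[X in _ --> X](sqrr_sign R i) [X in _ --> X]expr2; apply: cvgMr; exact: cv.
  near=> N; apply: (le_lt_trans (Hp _ (ltn_ord i : (i <= n)%N))).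
  rewrite -subr_gt0 -mulrBr.
  have : 0 < (-1) ^+ i * ((S (y N) (p i) - S x (p i)) / N.+1%:R^-1).
    by near: N; exact: (cvgr_gt _ cv _ ltr01).
  by rewrite mulrA pmulr_lgt0// invr_gt0 invr_gt0 ltr0n.
have [N [HN1 HN2]] : exists N, (forall j, 0 <= y N j <= 1) /\ (forall i : 'I_n.+1,
    tau * F (odd i) (p i) < (-1) ^+ i * S (y N) (p i)).
  near \oo => N; exists N; split; near: N; [exact: N1|exact: N2].
(* The slack in units of the width; [tau] can grow by the least of these. *)
pose a i := ((-1) ^+ i * S (y N) (p i) - tau * F (odd i) (p i)) / F (odd i) (p i).
have [i im|c c0 Hc] := @positive_lower_bound R a n.
  by rewrite divr_gt0// subr_gt0; exact: (HN2 (Ordinal (im : (i < n.+1)%N))).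
exists (y N), (tau + c); split; first by rewrite ltrDl.
split => // i im; have := Hc _ im; by rewrite /a ler_pdivlMr// mulrDl lerBrDl.
Unshelve. all: by end_near. Qed.

Lemma smooth_equioscillation (X0 : R) : exists X (x : 'I_n -> R) p tau, [/\ X0 <= X /\ 0 < tau,
  forall j, 0 <= x j <= 1, (forall i, 0 <= p i) /\ (forall i, (i < n)%N -> p i <= p i.+1),
  forall i, (i <= n)%N -> (-1) ^+ i * S x (p i) = tau * F (odd i) (p i) &
  forall (b : bool) t, 0 <= t <= X -> (-1) ^+ b * S x t <= tau * F b t].
Proof.
have [X [x1 [p1 [tau1 [X0X tau10 fe1]]]]] := feasible_exists X0.
have [x [p [tau [tt fe maxi]]]] := feasible_max W r0 cw cF m0 Fm tau10 fe1.
have t0 : 0 < tau by exact: lt_le_trans tt.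
have [x01 pX pp Hp] := fe; have p0 i : 0 <= p i by have /andP[] := pX i.
have tube (b : bool) t : 0 <= t <= X -> (-1) ^+ b * S x t <= tau * F b t.
  move=> /andP[t0' tX]; rewrite leNgt; apply/negP => Ht.
  have pos i : (i <= n)%N -> 0 < (-1) ^+ i * S x (p i).
    by move=> im; rewrite (lt_le_trans _ (Hp _ im))// mulr_gt0.
  have pt : 0 < (-1) ^+ b * S x t by rewrite (lt_trans _ Ht)// mulr_gt0.
  (* The first two cases give more alternations than [n] knots allow; the third yields a feasible
     configuration with slack at [l], against maximality. *)
  have [al|[al|[l [ln lb pl]]]] := exchange_point p0 t0' pp pos pt.
  - have [] := @alternates_smooth_spline _ _ _ W w n x n.+2 false cw w0 al.
    by rewrite addn0 ltnn.
  - have [] := @alternates_smooth_spline _ _ _ W w n x n.+2 true cw w0 al.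
    by rewrite addn1 ltnNge leqnSn.
  - pose p' := replace_point p l t.
    have p'l : p' l = t by rewrite /p' /replace_point eqxx.
    have [||x' [tau' [tt' fe']]] := @feasible_improve X x p' tau l t0 _ ln.
    + split => // [i|i im]; rewrite /p' /replace_point.
        by case: ifP => // _; rewrite t0'.
      case: eqP => [->|_]; last exact: Hp.
      by rewrite lb -[(-1) ^+ l]signr_odd lb; exact: ltW.
    + by rewrite p'l lb -[(-1) ^+ l]signr_odd lb.
    + by have := maxi _ _ _ fe'; rewrite leNgt tt'.
exists X, x, p, tau; split => // i im.
apply/eqP; rewrite eq_le Hp// andbT -[(-1) ^+ i]signr_odd; apply: tube; exact: pX.
Qed.

End SmoothedEquioscillation.

(** * The tube seen from the limit at infinity, and tools for sharpening the signs *)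

Section Existence.
Context {R : realType}.
Notation mu := (@lebesgue_measure R).

Lemma squashN (u : R) : squash (- u) = - squash u.
Proof. by rewrite /squash normrN mulNr. Qed.

Lemma squash_inj : injective (@squash R).
Proof.
have neg (u : R) : u < 0 -> squash u < 0.
  by move=> u0; rewrite /squash pmulr_llt0// invr_gt0 ltr_wpDr.
have H (u s : R) : 0 <= u -> 0 <= s -> squash u = squash s -> u = s.
  by move=> u0 s0 E; rewrite -(squashK u0) -(squashK s0) E.
move=> u s; have [u0|u0] := leP 0 u; have [s0|s0] := leP 0 s => E.
- exact: H.
- by have := neg _ s0; rewrite -E ltNge squash_ge0.
- by have := neg _ u0; rewrite E ltNge squash_ge0.
- by apply: oppr_inj; apply: H; rewrite ?oppr_ge0 ?ltW// !squashN E.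
Qed.

Lemma squash_ne_ae n (x : 'I_n -> R) : {ae mu, forall u, forall j, squash u != x j}.
Proof.
have H j : {ae mu, forall u, squash u != x j}.
  have [[c Ec]|nc] := pselect (exists c, squash c = x j).
    exists [set c]; split; [exact: measurable_set1|exact: lebesgue_measure_set1|].
    move=> u /= /negP; rewrite negbK => /eqP; rewrite -Ec; exact: squash_inj.
  by apply: aeW => u; apply/eqP => E; apply: nc; exists u.
have : \forall u \near almost_everywhere mu, forall j, squash u != x j.
  by apply: (@filter_forall _ _ _ _ (ae_filter_ringOfSetsType mu)) => j; exact: H.
exact.
Qed.

Lemma squash_scaled_cvg (M y_ : nat -> R) (y : R) : y != 0 -> (forall N, 0 < M N) ->
  (M N)^-1 @[N --> \oo] --> (0 : R) -> y_ N @[N --> \oo] --> y ->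
  squash (M N * y_ N) @[N --> \oo] --> y / `|y|.
Proof.
move=> y0 M0 Moo yy.
have -> : (fun N => squash (M N * y_ N)) = fun N => y_ N / ((M N)^-1 + `|y_ N|).
  apply/funext => N; rewrite /squash normrM gtr0_norm//.
  have d0 : 1 + M N * `|y_ N| != 0 by rewrite gt_eqF// ltr_wpDr// mulr_ge0// ltW.
  by field; rewrite gt_eqF//= mulrC.
apply: cvgM => //; apply: cvgV; first by rewrite normr_eq0.
rewrite -[X in _ --> X]add0r; apply: cvgD => //.
exact: cvg_norm.
Qed.

Variables (r : nat) (k : R -> R).
Hypotheses (W : weight r k) (r0 : (0 < r)%N).

Lemma itail_eq_on m (f f' : R -> R) (U t : R) : (forall u, U <= u -> f u = f' u) ->
  U <= t -> itail m f t = itail m f' t.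
Proof.
move=> H; elim: m t => [|m IHm] t Ut; first exact: H.
rewrite !itailS; apply: eq_Rintegral => u; rewrite inE/= in_itv/= andbT => tu.
by apply: IHm; exact: le_trans tu.
Qed.

(** Past the last finite knot the sign is constant, so the spline is there plus or minus the
    positive [r]-th tail of [k]. This excludes a limit amplitude 0. *)
Lemma spline_neq0 n (x : 'I_n -> R) : (forall j, 0 <= x j <= 1) ->
  exists2 t, 0 <= t & spline r k x t != 0.
Proof.
move=> x01; pose U := \sum_(j < n | x j < 1) unsquash (x j).
have U0 : 0 <= U.
  apply: sumr_ge0 => j xj; apply: unsquash_ge0; rewrite xj andbT.
  by have /andP[] := x01 j.
exists U => //; pose e : R := (-1) ^+ nknots x U.
have E u : U <= u -> signed_weight k x u = e * k u.
  move=> Uu; rewrite /signed_weight mulrC knot_signE; congr (_ ^+ _ * _).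
  have K (s : R) : U <= s -> nknots x s = (\sum_(j < n) (x j < 1)%R)%N.
    move=> Us; apply: eq_bigr => j _; congr nat_of_bool.
    have [xj|xj] := ltP (x j) 1; last first.
      by apply/negbTE; rewrite -ltNge (lt_le_trans (squash_lt1 _)).
    have xj0 : 0 <= x j < 1 by rewrite xj andbT; have /andP[] := x01 j.
    rewrite leNgt squash_lt_knot//; last exact: le_trans Us.
    rewrite -leNgt (le_trans _ Us)//.
    rewrite /U (bigD1 j)//= lerDl; apply: sumr_ge0 => i /andP[xi _].
    by apply: unsquash_ge0; rewrite xi andbT; have /andP[] := x01 i.
  by rewrite !K.
rewrite /spline (itail_eq_on r E (lexx U)).
rewrite (itailZ e W ler01 (weight_dominated W) (leqnn r)) mulf_neq0//.
  by rewrite signr_eq0.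
by rewrite gt_eqF// (itail_gt0 _ W).
Qed.

Variables (fp fm : R -> R) (Lp Lm : R).
Hypotheses (cfp : continuous fp) (cfm : continuous fm).
Hypotheses (Lp0 : 0 < Lp) (Lm0 : 0 < Lm).
Hypotheses (fpL : forall t, Lp <= fp t) (fmL : forall t, Lm <= fm t).

(* [v] is the distance, in units of [tau], between the limit at infinity and the boundary
   touched by the last oscillation; [tau * offset n v] is that limit. *)
Definition offset (n : nat) (v : R) := if odd n then v - Lm else Lp - v.

(** Since [spline] tends to 0, the function with the prescribed limit is
    [tau * offset n v + spline]; these are the widths of the tube, in units of [tau], measured from
    that limit. *)
Definition tube n v (b : bool) t := if b then fm t + offset n v else fp t - offset n v.

Definition equioscillates n (v tau : R) (x : 'I_n -> R) (s : nat -> R) :=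
  [/\ 0 < tau, (forall j, 0 < x j < 1) /\ injective x,
      (forall i, 0 <= s i) /\ (forall i, (i < n)%N -> s i < s i.+1),
      forall i, (i <= n)%N -> (-1) ^+ i * spline r k x (s i) = tau * tube n v (odd i) (s i) &
      forall (b : bool) t, 0 <= t -> (-1) ^+ b * spline r k x t <= tau * tube n v b t].

Lemma tube_last_ge n v t : v <= tube n v (odd n) t.
Proof.
rewrite /tube /offset; case: (odd n); first by have := fmL t; lra.
by have := fpL t; lra.
Qed.

(** At [v = Lp + Lm] the width on the side not touched last may tend to 0 at infinity, so that value
    is reached only in the limit. *)
Lemma tube_min n v b t : 0 < v < Lp + Lm -> Num.min v (Lp + Lm - v) <= tube n v b t.
Proof.
move=> /andP[v0 vS]; rewrite ge_min /tube /offset; have := fmL t; have := fpL t => H1 H2.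
by case: b; case: (odd n); apply/orP; try (by left; lra); right; lra.
Qed.

Lemma continuous_tube n v b : continuous (tube n v b).
Proof.
move=> t; rewrite /tube; case: b.
  by apply: cvgD; [exact: cfm|exact: cvg_cst].
by apply: cvgB; [exact: cfp|exact: cvg_cst].
Qed.

Lemma tube_cvg n (v_ : nat -> R) v b (p_ : nat -> R) p :
  v_ N @[N --> \oo] --> v -> p_ N @[N --> \oo] --> p ->
  tube n (v_ N) b (p_ N) @[N --> \oo] --> tube n v b p.
Proof.
move=> vv pp.
have oo : offset n (v_ N) @[N --> \oo] --> offset n v.
  by rewrite /offset; case: (odd n); apply: cvgB => //; exact: cvg_cst.
rewrite /tube; case: b.
  by apply: cvgD => //; apply: (@continuous_cvg _ _ _ _ _ _ fm) => //; exact: cfm.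
by apply: cvgB => //; apply: (@continuous_cvg _ _ _ _ _ _ fp) => //; exact: cfp.
Qed.

Lemma equioscillation_knots n v tau (x : 'I_n -> R) (s : nat -> R) : 0 < v <= Lp + Lm ->
  0 < tau -> (forall i, 0 <= s i) -> (forall i, (i < n)%N -> s i <= s i.+1) ->
  (forall i, (i <= n)%N -> (-1) ^+ i * spline r k x (s i) = tau * tube n v (odd i) (s i)) ->
  (forall j, 0 < x j < 1) /\ injective x.
Proof.
move=> /andP[v0 vS] t0 s0 ss Hs.
(* Shifted away from its limit, the spline has one more sign change, near infinity. *)
pose a := - ((-1) ^+ n * (tau * (v / 2))).
have e0 : 0 < tau * (v / 2) by rewrite mulr_gt0// divr_gt0.
have [T sT HT] : exists2 T, s n <= T & `|spline r k x T| < tau * (v / 2).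
  have /cvgrPdist_lt/(_ _ e0) H := spline_cvg_at_oo W r0 x.
  near (pinfty_nbhs R) => T; exists T.
    by near: T; apply: nbhs_pinfty_ge; rewrite num_real.
  by rewrite -normrN -[X in `|X|]sub0r; near: T.
apply: (@spline_knots_interior _ r k W r0 n x a).
exists (fun i => if (i <= n)%N then s i else T); split.
- by move=> i; case: ifP => // _; exact: le_trans sT.
- move=> i; rewrite !ltnS => im; rewrite im; case: ifP => im'; first exact: ss.
  by have -> : i = n by apply/eqP; rewrite eqn_leq im leqNgt im'.
- move=> i; rewrite ltnS leq_eqVlt => /predU1P[->|im].
    rewrite ltnn mul1r /a exprS -(signr_odd _ n); move: HT; rewrite ltr_norml => /andP[].
    by case: (odd n); rewrite /= ?expr0 ?expr1; lra.
  rewrite ltnS in im; rewrite im mul1r mulrDr Hs// /a.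
  have T1 : tau * v <= tau * tube n v (odd n) (s i) by rewrite ler_pM2l// tube_last_ge.
  have T2 : 0 <= tau * tube n v (~~ odd n) (s i).
    by rewrite mulr_ge0 ?(ltW t0)// /tube /offset; case: (odd n) => /=;
      have := fpL (s i); have := fmL (s i); lra.
  rewrite -(signr_odd _ i) -(signr_odd _ n); move: T1 T2 e0.
  by case: (odd i); case: (odd n); rewrite /= ?expr0 ?expr1; lra.
Unshelve. all: by end_near. Qed.

End Existence.

(** * Sharp signs and the whole half-line, by compactness *)

Section Limit.
Context {R : realType}.
Notation mu := (@lebesgue_measure R).
Variables (r : nat) (k : R -> R).
Hypotheses (W : weight r k) (r0 : (0 < r)%N).
Variables (fp fm : R -> R) (Lp Lm : R).
Hypotheses (cfp : continuous fp) (cfm : continuous fm).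
Hypotheses (Lp0 : 0 < Lp) (Lm0 : 0 < Lm).
Hypotheses (fpL : forall t, Lp <= fp t) (fmL : forall t, Lm <= fm t).

Notation tube := (tube fp fm Lp Lm).

Lemma smooth_weight_cvg_sign n (M : nat -> R) (x_ : nat -> 'I_n -> R) (x : 'I_n -> R) u :
  (forall N, 0 < M N) -> (M N)^-1 @[N --> \oo] --> (0 : R) ->
  (forall j, x_ N j @[N --> \oo] --> x j) -> (forall j, squash u != x j) ->
  smooth_weight k (fun=> M N) (x_ N) u @[N --> \oo] --> signed_weight k x u.
Proof.
move=> M0 Moo xx ux; have P0 : knot_poly x u != 0.
  by apply/prodf_neq0 => j _; rewrite subr_eq0 eq_sym.
apply: cvgMr; have -> : knot_sign x u = knot_poly x u / `|knot_poly x u|.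
  by rewrite {1}knot_polyE mulfK// normr_eq0.
apply: squash_scaled_cvg => //; apply: cvgr_prod => j.
by apply: cvgB; [exact: xx|exact: cvg_cst].
Qed.

Lemma equioscillation_exists n (v : R) : 0 < v <= Lp + Lm ->
  exists tau (x : 'I_n -> R) s, equioscillates r k fp fm Lp Lm v tau x s.
Proof.
move=> vS; have /andP[v0 vL] := vS.
(* Shrinking [v] slightly keeps it below [Lp + Lm], as [tube_min] requires; the shift by 2 keeps it
   above [v / 2]. *)
pose h (N : nat) : R := N.+2%:R^-1.
pose v_ (N : nat) := v * (1 - h N).
have N2 (N : nat) : 0 < h N <= 2^-1.
  by rewrite invr_gt0 ltr0n/= lef_pV2 ?posrE ?ltr0n// ler_nat.
have v_lo N : v / 2 <= v_ N.
  by rewrite /v_ ler_pM2l//; have /andP[] := N2 N; move: (h N) => hN; lra.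
have v_0 N : 0 < v_ N by rewrite (lt_le_trans _ (v_lo N))// divr_gt0.
have v_hi N : v_ N < Lp + Lm.
  by rewrite (lt_le_trans _ vL)// /v_ gtr_pMr//; have /andP[] := N2 N; move: (h N) => hN; lra.
have vv : v_ N @[N --> \oo] --> v.
  rewrite -[X in _ --> X]mulr1; apply: cvgMr; rewrite -[X in _ --> X]subr0.
  apply: cvgB; first exact: cvg_cst.
  by have := @cvg_harmonic R; rewrite -(cvg_shiftS (@harmonic R)).
have /choice[X /choice[x_ /choice[p_ /choice[tau_ H]]]] : forall N : nat,
    exists (X : R) (x : 'I_n -> R) (p : nat -> R) (tau : R), [/\ N%:R <= X /\ 0 < tau,
  forall j, 0 <= x j <= 1, (forall i, 0 <= p i) /\ (forall i, (i < n)%N -> p i <= p i.+1),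
  forall i, (i <= n)%N -> (-1) ^+ i * smooth_spline r k (fun=> N.+1%:R) x (p i) =
    tau * tube n (v_ N) (odd i) (p i) &
  forall (b : bool) t, 0 <= t <= X ->
    (-1) ^+ b * smooth_spline r k (fun=> N.+1%:R) x t <= tau * tube n (v_ N) b t].
  move=> N; have vN : 0 < v_ N < Lp + Lm by rewrite v_0 v_hi.
  apply: (@smooth_equioscillation _ _ _ W r0 n (fun=> N.+1%:R) N.+1%:R _ _ _
    (tube n (v_ N)) (Num.min (v_ N) (Lp + Lm - v_ N))) => //.
  - by move=> u; exact: cvg_cst.
  - by move=> b; exact: continuous_tube.
  - by rewrite lt_min v_0 subr_gt0 v_hi.
  - by move=> b t; exact: tube_min.
have cN N : continuous (fun _ : R => N.+1%:R : R) by move=> u; exact: cvg_cst.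
pose S N := smooth_spline r k (fun=> N.+1%:R) (x_ N).
have Sk N t : `|S N t| <= itail r k t by exact: smooth_spline_norm.
(* The width at the last point is at least [v / 2]. This bounds [tau_ N] now and, once the limit of
   [tau_] is known to be positive, the last points too. *)
have last_le N : tau_ N * (v / 2) <= itail r k (p_ N n).
  have [[_ t0] _ _ /(_ n (leqnn n)) Hn _] := H N.
  apply: (@le_trans _ _ (tau_ N * tube n (v_ N) (odd n) (p_ N n))).
    rewrite ler_pM2l// (le_trans (v_lo N))//; exact: tube_last_ge.
  by rewrite -Hn (le_trans (ler_norm _))// normrM normrX normrN1 expr1n mul1r; exact: Sk.
pose C := itail r k 0 / (v / 2).
have tauC N : 0 <= tau_ N <= C.
  have [[_ t0] _ [p0 _] _ _] := H N; rewrite ltW//= ler_pdivlMr ?divr_gt0//.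
  by apply: (le_trans (last_le N)); exact: (itail_nincr W (leqnn r) (p0 n)).
(* The points are not yet bounded, hence compactness is applied to their squashed values. *)
pose u (i : ('I_n + 'I_n.+1) + unit) N := match i with
  | inl (inl j) => x_ N j | inl (inr i) => squash (p_ N i) | inr _ => tau_ N end.
have [i N|f [l [foo fl]]] := @bolzano_weierstrass_fin R _ u (Num.max 1 C).
  have [_ x01 [p0 _] _ _] := H N; rewrite le_max.
  case: i => [[j|i]|_] /=; apply/orP.
  - by left; have /andP[? ?] := x01 j; rewrite ger0_norm.
  - by left; exact: squash_norm.
  - by right; have /andP[? ?] := tauC N; rewrite ger0_norm.
pose x j := l (inl (inl j)); pose q i := l (inl (inr (inord i))); pose tau := l (inr tt).
have xl j : x_ (f N) j @[N --> \oo] --> x j by exact: (fl (inl (inl j))).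
have ql i : squash (p_ (f N) (inord i : 'I_n.+1)) @[N --> \oo] --> q i.
  exact: (fl (inl (inr (inord i)))).
have taul : tau_ (f N) @[N --> \oo] --> tau by exact: (fl (inr tt)).
have vl : v_ (f N) @[N --> \oo] --> v by exact: (cvg_comp _ _ foo vv).
have x01 j : 0 <= x j <= 1.
  apply/andP; split; [apply: (cvgr_to_ge (xl j))|apply: (cvgr_to_le (xl j))];
    by apply: nearW => N; have [_ /(_ j)/andP[]] := H (f N).
have wl : {ae mu, forall u, smooth_weight k (fun=> (f N).+1%:R) (x_ (f N)) u
    @[N --> \oo] --> signed_weight k x u}.
  apply: (@filterS _ _ (ae_filter_ringOfSetsType mu) _ _ _ (squash_ne_ae x)) => z xz.
  apply: (smooth_weight_cvg_sign (M := fun N => (f N).+1%:R)) => //.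
  exact: (cvg_comp _ _ foo cvg_harmonic).
have Sl (p : nat -> R) (t : R) : (forall N, 0 <= p N) -> 0 <= t -> p N @[N --> \oo] --> t ->
    S (f N) (p N) @[N --> \oo] --> spline r k x t.
  move=> p0 t0 pt; apply: (itail_cvg_comp W r0) => //.
  - by move=> N; exact: (smooth_weight_dominated W _ (cN _)).
  - exact: (signed_weight_dominated W).
have tubel (b : bool) (t : R) : 0 <= t -> (-1) ^+ b * spline r k x t <= tau * tube n v b t.
  move=> t0; have H1 : (-1) ^+ b * S (f N) t @[N --> \oo] --> (-1) ^+ b * spline r k x t.
    by apply: cvgMr; apply: Sl => //; exact: cvg_cst.
  have H2 : tau_ (f N) * tube n (v_ (f N)) b t @[N --> \oo] --> tau * tube n v b t.
    by apply: cvgM => //; apply: tube_cvg => //; exact: cvg_cst.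
  apply: (ler_cvg_to H1 H2).
  have /cvgryPger/(_ t (num_real t)) : (f N)%:R @[N --> \oo] --> (+oo : set_system R).
    exact: (cvg_comp _ _ foo (@cvgr_idn R)).
  apply: filterS => N tN; have [[fX _] _ _ _ Ht] := H (f N).
  by apply: Ht; rewrite t0/= (le_trans tN).
(* With [tau = 0] the limit spline would be squeezed to 0 on the half-line. *)
have tau0 : 0 < tau.
  rewrite lt_neqAle; apply/andP; split; last first.
    by apply: (cvgr_to_ge taul); apply: nearW => N; have /andP[] := tauC (f N).
  rewrite eq_sym; apply/eqP => t0; have [t tge0 /eqP] := spline_neq0 W x01; apply.
  apply/eqP; rewrite eq_le; have := tubel false t tge0; have := tubel true t tge0.
  by rewrite t0 !mul0r expr0 expr1 mul1r mulN1r oppr_le0 => -> ->.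
(* Beyond [T] the [r]-th tail of [k] is too small for [last_le] with [tau_] above [tau / 2], so the
   last points eventually stay below [T]. *)
have [T T0 HT] : exists2 T, 0 <= T & forall t, T <= t -> itail r k t < tau / 2 * (v / 2).
  have e0 : 0 < tau / 2 * (v / 2) by rewrite mulr_gt0// divr_gt0.
  have rr : (0 < r <= r)%N by rewrite r0 leqnn.
  have /cvgrPdist_lt/(_ _ e0) Hk := itail_cvg_at_oo W ler01 (weight_dominated W) rr.
  near (pinfty_nbhs R) => T; exists T.
    by near: T; apply: nbhs_pinfty_ge; rewrite num_real.
  move=> t Tt; apply: (le_lt_trans (itail_nincr W (leqnn r) Tt)).
  apply: (le_lt_trans (ler_norm _)); rewrite -normrN -[X in `|X|]sub0r.
  by near: T.
have p_T : \forall N \near \oo, p_ (f N) n < T.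
  have t2 : tau / 2 < tau by rewrite ltr_pdivrMr// ltr_pMr// ltr1n.
  near=> N; rewrite ltNge; apply/negP => Tp; have := HT _ Tp; rewrite ltNge.
  move/negP; apply; apply: le_trans (last_le (f N)); rewrite ler_pM2r ?divr_gt0//.
  by near: N; exact: (cvgr_ge _ taul _ t2).
have pmono N i : (i <= n)%N -> p_ (f N) i <= p_ (f N) n.
  have [_ _ [_ pp] _ _] := H (f N).
  move=> im; rewrite -(subKn im); elim: (n - i)%N (leq_subr i n) => [|d IHd] dn.
    by rewrite subn0.
  apply: le_trans (IHd (ltnW dn)).
  have E : (n - d = (n - d.+1).+1)%N by rewrite subnSK.
  by rewrite E; apply: pp; rewrite -E leq_subr.
have q01 i : 0 <= q i < 1.
  apply/andP; split.
    apply: (cvgr_to_ge (ql i)); apply: nearW => N; apply: squash_ge0.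
    by have [_ _ [] ] := H (f N).
  apply: le_lt_trans (squash_lt1 T); apply: (cvgr_to_le (ql i)).
  near=> N; apply: squash_le; first by have [_ _ [] ] := H (f N).
  apply: (@le_trans _ _ (p_ (f N) n)); last by apply: ltW; near: N.
  by apply: pmono; rewrite -ltnS.
pose s i := unsquash (q i).
have s0 i : 0 <= s i by exact: unsquash_ge0.
have sl i : p_ (f N) (inord i : 'I_n.+1) @[N --> \oo] --> s i.
  have -> : (fun N => p_ (f N) (inord i : 'I_n.+1)) =
      fun N => unsquash (squash (p_ (f N) (inord i : 'I_n.+1))).
    by apply/funext => N; rewrite squashK//; have [_ _ [] ] := H (f N).
  have /andP[_ q1] := q01 i; apply: cvgM; first exact: ql.
  apply: cvgV; first by rewrite subr_eq0 eq_sym lt_eqF.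
  by apply: cvgB; [exact: cvg_cst|exact: ql].
have ss i : (i < n)%N -> s i <= s i.+1.
  move=> im; apply: (ler_cvg_to (sl i) (sl i.+1)); apply: nearW => N.
  by have [_ _ [_ pp] _ _] := H (f N); rewrite !inordK ?ltnS//; [exact: pp|exact: ltnW].
have Hs i : (i <= n)%N -> (-1) ^+ i * spline r k x (s i) = tau * tube n v (odd i) (s i).
  move=> im; have H1 : (-1) ^+ i * S (f N) (p_ (f N) (inord i : 'I_n.+1)) @[N --> \oo] -->
      (-1) ^+ i * spline r k x (s i).
    by apply: cvgMr; apply: Sl => // N; have [_ _ [] ] := H (f N).
  have H2 : tau_ (f N) * tube n (v_ (f N)) (odd i) (p_ (f N) (inord i : 'I_n.+1))
      @[N --> \oo] --> tau * tube n v (odd i) (s i).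
    by apply: cvgM => //; exact: tube_cvg.
  have E : (fun N => (-1) ^+ i * S (f N) (p_ (f N) (inord i : 'I_n.+1))) =
      fun N => tau_ (f N) * tube n (v_ (f N)) (odd i) (p_ (f N) (inord i : 'I_n.+1)).
    by apply/funext => N; have [_ _ _ /(_ _ im) Hi _] := H (f N); rewrite inordK.
  by rewrite E in H1; exact: (cvg_unique _ H1 H2).
exists tau, x, s; split => //; first exact: equioscillation_knots tau0 s0 ss Hs.
(* Coinciding neighbours would make the two widths there add up to 0, but their sum is [fp + fm]. *)
split=> // i im; rewrite lt_neqAle ss// andbT; apply/eqP => E.
have := Hs _ im; have := Hs _ (ltnW im); rewrite E exprS mulN1r mulNr => -> /eqP.
rewrite eq_sym -addr_eq0 -mulrDr mulf_eq0 (gt_eqF tau0)/= gt_eqF// /tube/=.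
by have := fpL (s i.+1); have := fmL (s i.+1); case: (odd i) => /=; lra.
Unshelve. all: by end_near. Qed.

End Limit.

(** * Dependence of the amplitude on [n] and on [v] *)

Section Monotonicity.
Context {R : realType}.
Variables (r : nat) (k : R -> R).
Hypotheses (W : weight r k) (r0 : (0 < r)%N).
Variables (fp fm : R -> R) (Lp Lm : R).
Hypotheses (Lp0 : 0 < Lp) (Lm0 : 0 < Lm).
Hypotheses (fpL : forall t, Lp <= fp t) (fmL : forall t, Lm <= fm t).

Notation tb := (tube fp fm Lp Lm).
Notation off := (offset Lp Lm).
Notation equi := (equioscillates r k fp fm Lp Lm).

Let bound (b : bool) := if b then fm else fp.

Let bound_min b t : Num.min Lp Lm <= bound b t.
Proof.
by rewrite ge_min /bound; case: b; apply/orP; [right|left].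
Qed.

Let min0 : 0 < Num.min Lp Lm.
Proof. by rewrite lt_min Lp0. Qed.

Let tubeE n v i t : tb n v (odd i) t = bound (odd i) t - (-1) ^+ i * off n v.
Proof.
rewrite /tube -(signr_odd _ i) /bound; case: (odd i); rewrite /= ?expr0 ?expr1; ring.
Qed.

(** At its oscillation points the function of larger amplitude touches its boundary, while the other
    stays inside the thinner tube. The gap is uniform, which leaves room for a small shift by a
    constant. *)
Lemma oscillation_gap n n' v v' tau tau' (x : 'I_n -> R) (x' : 'I_n' -> R) s s' i :
  equi v tau x s -> equi v' tau' x' s' -> tau' < tau ->
  (i <= n)%N -> (tau - tau') * Num.min Lp Lm <= (-1) ^+ i *
    ((tau * off n v - tau' * off n' v') + (spline r k x (s i) - spline r k x' (s i))).
Proof.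
move=> [t0 _ [s0 _] Hs _] [_ _ _ _ H'] tt im.
have := H' (odd i) (s i) (s0 i); rewrite [(-1) ^+ odd i]signr_odd => h'.
have := Hs i im => h; move: h h'; rewrite !tubeE => h h'.
have : (tau - tau') * Num.min Lp Lm <= (tau - tau') * bound (odd i) (s i).
  by rewrite ler_pM2l ?subr_gt0.
by move: ((-1) ^+ i) (bound (odd i) (s i)) h h' => e b h h'; lra.
Qed.

(** Otherwise the difference alternates at all [n + 2] points of the first function. The difference
    of limits costs one alternation, and [n + 1] are still too many for the [n] knots of [x']. *)
Lemma equioscillation_adjacent n v v' tau tau' (x : 'I_n.+1 -> R) (x' : 'I_n -> R) s s' :
  equi v tau x s -> equi v' tau' x' s' -> tau <= tau'.
Proof.
move=> H H'; rewrite leNgt; apply/negP => tt.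
have [t0 _ [s0 ss] _ _] := H.
suff : (n.+1 <= n)%N by rewrite ltnn.
apply: (@alternates_cst_splineB _ _ _ W r0 n n.+1 x' x n.+1
  (tau * off n.+1 v - tau' * off n v')).
exists s; split=> [//|i|i]; first by rewrite ltnS => im; apply/ltW/ss.
rewrite ltnS => im; rewrite mul1r; apply: lt_le_trans (oscillation_gap H H' tt im).
by rewrite mulr_gt0// subr_gt0.
Qed.

Let no_alternates n (x x' : 'I_n -> R) (s : nat -> R) : (forall i, 0 <= s i) ->
  (forall i, (i < n)%N -> s i < s i.+1) ->
  ~ forall i, (i <= n)%N -> 0 < (-1) ^+ i * (spline r k x (s i) - spline r k x' (s i)).
Proof.
move=> s0 ss H; suff : (n.+1 <= n)%N by rewrite ltnn.
apply: (@alternates_splineB _ _ _ W n n x' x n.+1); exists s; split=> [//|i|i].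
  by rewrite ltnS => im; apply/ltW/ss.
by rewrite ltnS mul1r; exact: H.
Qed.

Let tube_last n v i t : odd i = odd n ->
  tb n v (odd i) t = bound (odd i) t - (if odd i then Lm else Lp) + v.
Proof. by rewrite /tube /offset /bound; case: (odd i); case: (odd n) => //= _; ring. Qed.

Let tube_other n v i t : odd i != odd n ->
  tb n v (odd i) t = bound (odd i) t - (if odd i then Lm else Lp) + (Lp + Lm - v).
Proof. by rewrite /tube /offset /bound; case: (odd i); case: (odd n) => //= _; ring. Qed.

Let bound_ge i t : 0 <= bound (odd i) t - (if odd i then Lm else Lp).
Proof. by rewrite subr_ge0 /bound; case: odd. Qed.

(** Suppose [tau < tau'], and let [a] be the difference of the limits. If [a] does not have the sign
    of the last oscillation, a small shift adds an alternation near infinity, giving [n + 2] with a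
    constant. If it does, removing [a] helps at points of the other parity, while at points of the
    same parity [v <= v'] makes the width for [v'] larger; this gives [n + 1] without a constant.
    Both are impossible. *)
Lemma equioscillation_nonincreasing n v v' tau tau' (x x' : 'I_n -> R) s s' :
  0 < v -> v <= v' ->
  equi v tau x s -> equi v' tau' x' s' -> tau' <= tau.
Proof.
move=> v0 vv' H H'; rewrite leNgt; apply/negP => tt.
have [t0 _ _ _ Htube] := H; have [t0' _ [s0 ss] Hs' _] := H'.
pose a := tau' * off n v' - tau * off n v.
have gap i (im : (i <= n)%N) := oscillation_gap H' H tt im.
have c0 : 0 < (tau' - tau) * Num.min Lp Lm by rewrite mulr_gt0// subr_gt0.
set c := _ * _ in c0 gap.
have [an|an] := lerP ((-1) ^+ n * a) 0; last first.
  apply: (@no_alternates n x' x s' s0 ss) => i im.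
  have [io|io] := eqVneq (odd i) (odd n).
    rewrite mulrBr Hs'// subr_gt0.
    have := Htube (odd i) (s' i) (s0 i); rewrite [(-1) ^+ odd i]signr_odd => /le_lt_trans; apply.
    rewrite !tube_last//; have := bound_ge i (s' i); set d := _ - _ => d0.
    apply: (@le_lt_trans _ _ (tau * (d + v'))); first by rewrite ler_pM2l// lerD2l.
    by rewrite ltr_pM2r// ltr_wpDl// (lt_le_trans v0).
  have := gap i im; rewrite -/a mulrDr.
  have -> : (-1) ^+ i = - (-1) ^+ n :> R.
    move: io; rewrite -(signr_odd _ i) -(signr_odd _ n).
    by case: (odd i); case: (odd n); rewrite //= ?opprK.
  by rewrite !mulNr; lra.
have [T sT HT] : exists2 T, s' n <= T &
    `|spline r k x' T - spline r k x T| < c / 2.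
  have c2 : 0 < c / 2 by rewrite divr_gt0.
  have : spline r k x' t - spline r k x t @[t --> +oo] --> (0 : R).
    by rewrite -[X in _ --> X](subrr 0); apply: cvgB; exact: spline_cvg_at_oo.
  move=> /cvgrPdist_lt/(_ _ c2) Hc.
  near (pinfty_nbhs R) => T; exists T.
    by near: T; apply: nbhs_pinfty_ge; rewrite num_real.
  by rewrite -normrN -[X in `|X|]sub0r; near: T.
suff : (n.+1 <= n)%N by rewrite ltnn.
apply: (@alternates_cst_splineB _ _ _ W r0 n n x x' n.+1 (a - (-1) ^+ n * (c / 2))).
exists (fun i => if (i <= n)%N then s' i else T); split.
- by move=> i; case: ifP => // _; exact: le_trans sT.
- move=> i; rewrite !ltnS => im; rewrite im; case: ifP => im'; first exact/ltW/ss.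
  by have -> : i = n by apply/eqP; rewrite eqn_leq im leqNgt im'.
- move=> i; rewrite ltnS leq_eqVlt => /predU1P[->|].
    rewrite ltnn mul1r exprS; move: an HT; rewrite ltr_norml -(signr_odd _ n) => + /andP[].
    by case: (odd n); rewrite /= ?expr0 ?expr1; lra.
  rewrite ltnS => im; rewrite im mul1r; have := gap i im; rewrite -/a.
  rewrite -(signr_odd _ i) -(signr_odd _ n).
  by case: (odd i); case: (odd n); rewrite /= ?expr0 ?expr1; lra.
Unshelve. all: by end_near. Qed.

(** If [v' * tau' < v * tau], then also [tau' < tau], and every scaled width for [v] exceeds that
    for [v']: on the side touched last by comparing [v * tau] with [v' * tau'], on the other since
    [Lp + Lm - v] decreases in [v]. So the splines without their limits would differ with [n + 1]
    alternations. *)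
Lemma equioscillation_scaled_nondecreasing n v v' tau tau' (x x' : 'I_n -> R) s s' :
  0 < v -> v < v' -> v' <= Lp + Lm ->
  equi v tau x s -> equi v' tau' x' s' -> v * tau <= v' * tau'.
Proof.
move=> v0 vv' vS H H'; rewrite leNgt; apply/negP => tv.
have [t0 _ [s0 ss] Hs _] := H; have [t0' _ _ _ Htube'] := H'.
have tt : tau' < tau.
  rewrite -(ltr_pM2l (lt_trans v0 vv')); apply: (lt_le_trans tv).
  by rewrite ler_pM2r// ltW.
apply: (@no_alternates n x x' s s0 ss) => i im.
rewrite mulrBr Hs// subr_gt0.
have := Htube' (odd i) (s i) (s0 i); rewrite [(-1) ^+ odd i]signr_odd => /le_lt_trans; apply.
have := bound_ge i (s i); have [io|io] := eqVneq (odd i) (odd n).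
  rewrite !tube_last//; set d := _ - _; move: d => d d0; rewrite !mulrDr.
  apply: ler_ltD; first by rewrite ler_wpM2r// ltW.
  by rewrite (mulrC tau') (mulrC tau).
rewrite !tube_other//; set d := _ - _ => d0.
apply: (@le_lt_trans _ _ (tau' * (d + (Lp + Lm - v)))).
  by rewrite ler_pM2l// lerD2l lerD2l lerN2 ltW.
by rewrite ltr_pM2r//; apply: ltr_wpDl => //; rewrite subr_gt0; exact: lt_le_trans vS.
Qed.

End Monotonicity.

(** * From Assumption 1 to a weight on the whole line *)

Section Extension.
Context {R : realType}.
Notation mu := (@lebesgue_measure R).

Definition extend0 (f : R -> R) (t : R) : R := f (Num.max 0 t).

Lemma extend0E f t : 0 <= t -> extend0 f t = f t.
Proof. by move=> t0; rewrite /extend0 max_r. Qed.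

Lemma extend0_continuous (f : R -> R) : cont_halfline f -> continuous (extend0 f).
Proof.
move=> /subspace_continuousP cf t.
have t0 : 0 <= Num.max 0 t by rewrite le_max lexx.
have /= {}cf : f @ within `[0, +oo[ (nbhs (Num.max 0 t)) --> f (Num.max 0 t).
  by apply: cf; rewrite /= in_itv/= t0.
apply: cvg_comp cf; move=> U /= HU.
have cmax : Num.max 0 s @[s --> t] --> Num.max 0 t.
  by apply: continuous_max; [exact: cvg_cst|exact: cvg_id].
have s0 (s : R) : 0 <= Num.max 0 s by rewrite le_max lexx.
by apply: (@filterS _ (nbhs t) _ _ _ _ (cmax _ HU)) => s /=; apply; rewrite in_itv/= s0.
Qed.

Lemma extend0_nonincreasing (f : R -> R) : noninc_halfline f ->
  forall s t, s <= t -> extend0 f t <= extend0 f s.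
Proof.
move=> H s t st; apply: H; first by rewrite le_max lexx.
by rewrite ge_max !le_max lexx/= st orbT.
Qed.

Lemma lim_infty_nonincreasing (f : R -> R) : noninc_halfline f -> pos_halfline f ->
  f t @[t --> +oo] --> lim_infty f /\ forall t, 0 <= t -> lim_infty f <= f t.
Proof.
move=> fni f0; pose E := [set f t | t in [set t | 0 <= t]].
have hE : has_inf E.
  split; first by exists (f 0); exists 0 => //=.
  by exists 0 => _ [t /= t0 <-]; apply: ltW; exact: f0.
have lo t : 0 <= t -> inf E <= f t by move=> t0; apply: (inf_lbound hE.2); exists t.
have fl : f t @[t --> +oo] --> inf E.
  apply/cvgrPdist_lt => e e0.
  have [_ [T /= T0 <-] HT] := inf_adherent e0 hE.
  near=> t; have Tt : T <= t by near: t; apply: nbhs_pinfty_ge; rewrite num_real.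
  rewrite ltr_norml; have := lo t (le_trans T0 Tt); have := fni _ _ T0 Tt; lra.
have -> : lim_infty f = inf E by exact: (cvg_lim _ fl).
by split.
Unshelve. all: by end_near. Qed.

(** For [B i] equal to the [(i + 1)]-st iterated tail at 0, this is the Taylor polynomial at 0, of
    degree below [m], of the [m]-th iterated tail. *)
Definition tail_taylor (B : nat -> R) (m : nat) : {poly R} :=
  \sum_(i < m) ((-1) ^+ (m - i - 1) * B i / ((m - i - 1)`!)%:R) *: 'X^(m - i - 1).

Lemma deriv_tail_taylor B m : (tail_taylor B m.+1)^`() = - tail_taylor B m.
Proof.
rewrite /tail_taylor big_ord_recr/= subSnn subnn expr0 derivD derivZ.
rewrite [X in _ + _ *: X](_ : _ = 0) ?scaler0 ?addr0; last by rewrite expr0 -[1]/(1%:P) derivC.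
rewrite raddf_sum -sumrN; apply: eq_bigr => i _.
rewrite [LHS]/= derivZ derivXn -scalerMnr scalerMnl -scaleNr; congr (_ *: _).
  have -> : (m.+1 - i - 1 = (m - i - 1).+1)%N.
    by rewrite -subnDA addn1 subSS -subnDA addn1 subnSK.
  rewrite factS natrM exprS -mulr_natr; field.
  by rewrite pnatr_eq0 -lt0n fact_gt0/= gt_eqF// ltr_pwDl.
by congr ('X^_); rewrite -!subnDA !addn1 subSS -subnS.
Qed.

Variables (g : R -> R).

Let gt := extend0 g.

Lemma weightS r : weight r.+1 gt -> weight r gt.
Proof. by case=> c0 c1 c2 H; split => // m mr; apply: H; exact: ltnW. Qed.

(** Integrating from 0 reproduces the tail minus its Taylor polynomial: the derivatives agree by
    [deriv_tail_taylor], and the value at 0 vanishes. *)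
Lemma iter_intE m (t : R) : weight m gt -> 0 <= t ->
  iter_int g m t = (-1) ^+ m * (itail m gt t - (tail_taylor (fun i => itail i.+1 gt 0) m).[t]).
Proof.
set B := fun i => _; elim: m t => [|m IHm] t Wm t0.
  by rewrite /tail_taylor big_ord0 horner0 subr0 expr0 mul1r /= -extend0E.
have Wm' := weightS Wm.
pose Phi n (u : R) : R := (-1) ^+ n * (itail n gt u - (tail_taylor B n).[u]).
have dPhi (u : R) : is_derive u 1 (Phi m.+1) (Phi m u).
  have dt : is_derive u 1 (itail m.+1 gt) (- itail m gt u).
    apply: (is_derive_itail Wm ler01 (weight_dominated Wm) (ltnSn m)) => _.
    by have [c _ _ _] := Wm; exact: c.
  have dp := is_derive_poly (tail_taylor B m.+1) u.
  have := is_deriveZ ((-1) ^+ m.+1) (is_deriveB dt dp).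
  rewrite deriv_tail_taylor hornerN opprK.
  have -> : (-1) ^+ m.+1 *: (- itail m gt u + (tail_taylor B m).[u]) = Phi m u.
    by rewrite /Phi exprS mulN1r scaleNr -scalerN opprD opprK.
  exact.
have cPhi : continuous (Phi m).
  move=> u; apply: cvgMr; apply: cvgB; last exact: continuous_horner.
  exact: (itail_weight_continuous Wm').
have Phi0 : Phi m.+1 0 = 0.
  rewrite /Phi /tail_taylor horner_sum big_ord_recr/= subSnn subnn.
  rewrite big1 ?add0r => [|i _]; last first.
    rewrite hornerZ hornerXn expr0n.
    by rewrite -subnDA addn1 subSS subn_eq0 leqNgt ltn_ord mulr0.
  by rewrite hornerZ hornerXn !expr0 mul1r mulr1 divr1 subrr mulr0.
have -> : iter_int g m.+1 t = \int[mu]_(s in `[0, t]) Phi m s.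
  apply: eq_Rintegral => s; rewrite inE/= in_itv/= => /andP[s0 _].
  exact: IHm.
rewrite -/(Phi m.+1 t); move: t0; rewrite le_eqVlt => /predU1P[<-|t0].
  by rewrite Phi0 set_itv1 Rintegral_set1.
have cPhi' u : Phi m.+1 z @[z --> u] --> Phi m.+1 u.
  by have [/derivable1_diffP /differentiable_continuous] := dPhi u.
have dLR : derivable_oo_LRcontinuous (Phi m.+1) 0 t.
  split; first by move=> u _; have [] := dPhi u.
    exact: cvg_at_right_filter.
  exact: cvg_at_left_filter.
have F' : {in `]0, t[, (Phi m.+1)^`()%classic =1 Phi m}.
  by move=> u _; rewrite derive1E (@derive_val _ _ _ _ _ _ _ (dPhi u)).
by rewrite /Rintegral (continuous_FTC2 t0 (continuous_subspaceT cPhi) dLR F') Phi0 /= subr0.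
Qed.

(** The sum in the integrand of [A_ g m] is exactly the Taylor polynomial subtracted in [iter_intE],
    so only the iterated tail remains. *)
Lemma A_tail m : weight m gt -> (forall i, (i < m)%N -> fine (A_ g i) = itail i.+1 gt 0) ->
  A_ g m = (\int[mu]_(t in `[0%R, +oo[) (itail m gt t)%:E)%E.
Proof.
move=> Wm HA; rewrite A_E; apply: eq_integral => t; rewrite inE/= in_itv/= andbT => t0.
congr (_%:E); rewrite iter_intE// mulrA -expr2 sqrr_sign mul1r.
rewrite [X in X + _](_ : _ = (tail_taylor (fun i => itail i.+1 gt 0) m).[t]).
  by rewrite addrC subrK.
rewrite /tail_taylor horner_sum; apply: eq_bigr => i _.
by rewrite hornerZ hornerXn HA.
Qed.

Lemma tail_integrable_extend (f : R -> R) : continuous f -> (forall t, 0 < f t) ->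
  (\int[mu]_(t in `[0%R, +oo[) (f t)%:E < +oo)%E -> tail_integrable f.
Proof.
move=> cf f0 H.
have mf (D : set R) : measurable_fun D (EFin \o f).
  by apply/measurable_EFinP; apply: measurable_funTS; exact: continuous_measurable_fun.
have pos (D : set R) : mu.-integrable D (EFin \o f) <-> (\int[mu]_(x in D) (f x)%:E < +oo)%E.
  rewrite (_ : (\int[mu]_(x in D) (f x)%:E)%E = (\int[mu]_(x in D) `|(EFin \o f) x|)%E).
    by split=> [/integrableP[]//|fy]; apply/integrableP; split => //; exact: mf.
  by apply: eq_integral => x _; rewrite /= gtr0_norm.
move=> t; have [t0|t0] := leP 0 t.
  have H0 : mu.-integrable `[0, +oo[ (EFin \o f) by exact/pos.
  by apply: integrableS H0 => //; apply: subset_itvr; rewrite bnd_simp.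
apply/pos; rewrite (@itv_bndbnd_setU _ _ _ (BLeft 0)) ?bnd_simp//; last exact: ltW.
rewrite ge0_integral_setU//=; last 2 first.
- by move=> x _; rewrite lee_fin ltW.
- by apply/disj_setPS => x [/=]; rewrite !in_itv/= => /andP[_ x0] /andP[]; rewrite leNgt x0.
rewrite lte_add_pinfty//; apply/pos.
have Ht : mu.-integrable `[t, 0] (EFin \o f).
  apply: continuous_compact_integrable; first exact: segment_compact.
  exact: continuous_subspaceT.
apply: integrableS Ht => //; first by apply: subset_itvl; rewrite bnd_simp.
exact: mf.
Qed.

(** Integrability and the values of the [A_ g i] go through one induction: finiteness of [A_ g m]
    makes the next tail integrable, and its value at 0 is then [A_ g m], as the next Taylor
    polynomial needs. *)
Lemma assumption1_weight r : assumption1 r g -> weight r gt.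
Proof.
move=> [cg g0 gni HA].
suff : forall m, (m <= r)%N -> weight m gt /\
    forall i, (i < m)%N -> fine (A_ g i) = itail i.+1 gt 0 by move=> /(_ r (leqnn r))[].
elim=> [|m IHm] mr.
  split => //; split => // [|t|]; first exact: extend0_continuous.
    by apply: g0; rewrite le_max lexx.
  exact: extend0_nonincreasing.
have [Wm Hm] := IHm (ltnW mr); have Am := A_tail Wm Hm; have Am' := HA _ mr.
rewrite Am in Am'; split.
  have [c0 c1 c2 H] := Wm; split => // i; rewrite ltnS leq_eqVlt => /predU1P[->|]; last exact: H.
  apply: tail_integrable_extend Am'; first exact: (itail_weight_continuous Wm).
  by move=> t; exact: (itail_gt0 _ Wm).
move=> i; rewrite ltnS leq_eqVlt => /predU1P[->|]; last exact: Hm.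
by rewrite Am.
Qed.

End Extension.

(** * Smoothness and finite knots: iterated tails are perfect splines *)

Section PerfectSplines.
Context {R : realType}.

Lemma deriv_halfline_is_derive (f : R -> R) (t l : R) :
  is_derive t 1 f l -> deriv_halfline f t l.
Proof.
move=> [df Df]; have : (h^-1 *: (f (h *: 1 + t) - f t)) @[h --> 0^'] --> l.
  by rewrite -Df; exact: df.
move=> /cvgrPdist_lt H; apply/cvgrPdist_lt => e e0.
have [d /= d0 Hd] := H e e0; exists d => //= s st sneq s0.
have := Hd (s - t); rewrite /= sub0r normrN distrC => /(_ st).
rewrite subr_eq0 => /(_ sneq); rewrite [_ *: 1]mulr1 subrK.
by rewrite [_ *: _]mulrC.
Qed.

Variables (r : nat) (k : R -> R).
Hypotheses (W : weight r k) (r0 : (0 < r)%N).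

Lemma is_derive_affine_itail (f : R -> R) m (c e t : R) : dominated k 1 f -> (m < r)%N ->
  (m = 0%N -> {for t, continuous f}) ->
  is_derive t 1 (fun s => c + e * itail m.+1 f s) (- e * itail m f t).
Proof.
move=> df mr cf.
have d1 := is_deriveZ e (is_derive_itail W ler01 df mr cf).
have := is_deriveD (is_derive_cst c t 1) d1.
by rewrite add0r [_ *: _]mulrN mulNr.
Qed.

Lemma Ck_halfline_affine_itail (f : R -> R) j m (c e : R) : dominated k 1 f ->
  (j < m <= r)%N -> Ck_halfline j (fun t => c + e * itail m f t).
Proof.
move=> df; elim: j m c e => [|j IHj] m c e /andP[jm mr] /=.
  apply: continuous_subspaceT => t; apply: cvgD; first exact: cvg_cst.
  apply: cvgMr; have mr' : (0 < m <= r)%N by rewrite jm.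
  exact: (itail_continuous W ler01 df mr').
case: m jm mr => // m jm mr; exists (fun t => 0 + - e * itail m f t).
  move=> t _; apply: deriv_halfline_is_derive; rewrite add0r.
  by apply: is_derive_affine_itail => // m0; rewrite m0 in jm.
by apply: IHj; rewrite -ltnS jm ltnW.
Qed.

Lemma derive1n_affine_itail (f : R -> R) j m (c e : R) : dominated k 1 f ->
  (j < m <= r)%N -> exists c', derive1n j (fun t => c + e * itail m f t) =
    fun t => c' + (-1) ^+ j * e * itail (m - j) f t.
Proof.
move=> df; elim: j => [|j IHj] /andP[jm mr].
  by exists c; apply/funext => t; rewrite subn0 expr0 mul1r.
have [|c' E] := IHj; first by rewrite (ltnW jm).
exists 0; rewrite derive1nS E; apply/funext => t.
have mj : (m - j = (m - j.+1).+1)%N by rewrite subnSK// ltnW.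
rewrite mj derive1E.
have D : is_derive t 1 (fun s => c' + (-1) ^+ j * e * itail (m - j.+1).+1 f s)
    (- ((-1) ^+ j * e) * itail (m - j.+1) f t).
  apply: is_derive_affine_itail => //; last by move=> /eqP; rewrite subn_eq0 leqNgt jm.
  by rewrite -mj (leq_trans (leq_subr _ _)).
by rewrite (@derive_val _ _ _ _ _ _ _ D) add0r exprS mulN1r !mulNr.
Qed.

Definition knot_seq n (x : 'I_n -> R) : seq R := sort <=%R [seq x j | j <- enum 'I_n].

Definition knot_time n (x : 'I_n -> R) (i : nat) : \bar R :=
  if i is i'.+1 then
    if (i' < n)%N then (unsquash (nth 0 (knot_seq x) i'))%:E else +oo%E
  else 0%E.

Lemma size_knot_seq n (x : 'I_n -> R) : size (knot_seq x) = n.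
Proof. by rewrite size_sort size_map size_enum_ord. Qed.

Lemma knot_seq_in n (x : 'I_n -> R) i : (i < n)%N ->
  exists j, nth 0 (knot_seq x) i = x j.
Proof.
move=> im; have : nth 0 (knot_seq x) i \in knot_seq x by rewrite mem_nth ?size_knot_seq.
by rewrite mem_sort => /mapP[j _ ->]; exists j.
Qed.

Lemma nknots_knot_seq n (x : 'I_n -> R) u :
  nknots x u = (\sum_(j < n) (nth 0%R (knot_seq x) j <= squash u)%R)%N.
Proof.
rewrite /nknots -(big_mkord xpredT (fun j => nat_of_bool (nth 0 (knot_seq x) j <= squash u))).
rewrite -[X in \sum_(0 <= _ < X) _](size_knot_seq x) -(big_nth _ xpredT
  (fun a => nat_of_bool (a <= squash u))).
rewrite (perm_big [seq x j | j <- enum 'I_n])/=; last by rewrite perm_sort.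
by rewrite big_map big_enum.
Qed.

Section Knots.
Variables (n : nat) (x : 'I_n -> R).
Hypotheses (x01 : forall j, 0 < x j < 1) (xinj : injective x).

Let x01' j : 0 <= x j < 1.
Proof. by have /andP[/ltW -> ->] := x01 j. Qed.

Lemma knot_seq_lt i j : (i < j < n)%N -> nth 0 (knot_seq x) i < nth 0 (knot_seq x) j.
Proof.
move=> /andP[ij jn].
have : sorted <%R (knot_seq x).
  rewrite lt_sorted_uniq_le sort_uniq map_inj_uniq// enum_uniq/=.
  by apply: sort_sorted; exact: le_total.
move=> /(sorted_ltn_nth lt_trans 0); apply => //; rewrite inE size_knot_seq//.
exact: ltn_trans jn.
Qed.

Lemma knot_time_lt i : (i <= n)%N -> (knot_time x i < knot_time x i.+1)%E.
Proof.
move=> im; rewrite /knot_time; case: ifP => im'; last first.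
  by case: i im im' => [|i] im im'; [exact: ltry|rewrite im ltry].
have [j Ej] := knot_seq_in x im'.
case: i im im' Ej => [|i] im im' Ej.
  by rewrite lte_fin Ej divr_gt0 ?subr_gt0//; have /andP[] := x01 j.
have [j' Ej'] := knot_seq_in x (ltnW im').
rewrite (ltnW im') lte_fin -lt_squash ?unsquash_ge0 ?Ej ?Ej'//.
by rewrite unsquashK// -Ej -Ej'; apply: knot_seq_lt; rewrite ltnSn.
Qed.

Lemma nknots_knot_time i u : (i <= n)%N -> (knot_time x i < u%:E)%E ->
  (u%:E < knot_time x i.+1)%E -> 0 <= u -> nknots x u = i.
Proof.
move=> im iu ui u0; rewrite nknots_knot_seq.
have H (j : 'I_n) : (nth 0 (knot_seq x) j <= squash u) = (j < i)%N.
  have [l El] := knot_seq_in x (ltn_ord j).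
  have [ji|ij] := ltnP j i.
    case: i im iu ui ji => // i im iu ui ji.
    rewrite /knot_time im lte_fin in iu; have [l' El'] := knot_seq_in x im.
    rewrite El' -lt_squash// -El' in iu; apply: ltW; apply: le_lt_trans iu.
    move: ji; rewrite ltnS leq_eqVlt => /predU1P[->//|ji].
    by apply/ltW/knot_seq_lt; rewrite ji.
  apply/negbTE; rewrite -ltNge.
  have i_n : (i < n)%N by exact: leq_ltn_trans (ltn_ord j).
  rewrite /knot_time i_n lte_fin in ui; have [l' El'] := knot_seq_in x i_n.
  rewrite El' -squash_lt_knot// -El' in ui; apply: (lt_le_trans ui).
  move: ij; rewrite leq_eqVlt => /predU1P[->//|ij].
  by apply/ltW/knot_seq_lt; rewrite ij ltn_ord.
under eq_bigr do rewrite H.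
rewrite [LHS](_ : _ = (\sum_(j < n | (j < i)%N) 1)%N); last first.
  by rewrite [RHS]big_mkcond; apply: eq_bigr => j _; case: ltnP.
by rewrite -(big_ord_widen _ (fun=> 1%N) im) sum1_card card_ord.
Qed.

Lemma knot_time_ge0 i : (0 <= knot_time x i)%E.
Proof.
case: i => [|i] //=; case: ifP => [im|_]; last exact: leey.
by have [j ->] := knot_seq_in x im; rewrite lee_fin unsquash_ge0.
Qed.

Lemma signed_weight_near i t : (i <= n)%N -> (knot_time x i < t%:E)%E ->
  (t%:E < knot_time x i.+1)%E -> \forall u \near t, signed_weight k x u = k u * (-1) ^+ i.
Proof.
move=> im it ti; have t0 : 0 < t by rewrite -lte_fin (le_lt_trans (knot_time_ge0 i)).
have H1 (a : \bar R) : (a < t%:E)%E -> \forall u \near t, (a < u%:E)%E.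
  case: a => [a| |]//; last by move=> _; near=> u; exact: ltNyr.
  by rewrite lte_fin => at'; near do rewrite lte_fin; exact: lt_nbhsr.
have H2 (a : \bar R) : (t%:E < a)%E -> \forall u \near t, (u%:E < a)%E.
  case: a => [a| |]//; last by move=> _; near=> u; exact: ltry.
  by rewrite lte_fin => at'; near do rewrite lte_fin; exact: lt_nbhsl.
near=> u; rewrite /signed_weight knot_signE (@nknots_knot_time i)//.
- by near: u; exact: H1.
- by near: u; exact: H2.
- by rewrite ltW//; near: u; exact: lt_nbhsr.
Unshelve. all: by end_near. Qed.

Lemma perfect_spline_shift (g : R -> R) (c : R) : (forall t, 0 <= t -> k t = g t) ->
  perfect_spline r g n (fun t => c + spline r k x t).
Proof.
move=> kg; have df := signed_weight_dominated W x.
have rr : (r.-1 < r <= r)%N by rewrite prednK// !leqnn.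
have -> : (fun t => c + spline r k x t) = (fun t => c + 1 * itail r (signed_weight k x) t).
  by apply/funext => t; rewrite mul1r.
split; first exact: Ck_halfline_affine_itail.
(* Each differentiation of an iterated tail brings a factor -1, whence the sign [(-1) ^+ r]. *)
exists (knot_time x), ((-1) ^+ r); split => //=.
- by rewrite ltnn.
- exact: knot_time_lt.
- by rewrite -signr_odd; case: (odd r); [right; rewrite expr1|left; rewrite expr0].
move=> i t im it ti; have t0 : 0 < t by rewrite -lte_fin (le_lt_trans (knot_time_ge0 i)).
have [c' ->] := derive1n_affine_itail c 1 df rr.
have -> : (r - r.-1 = 1)%N by rewrite -{1}(prednK r0) subSnn.
have near_t := signed_weight_near im it ti.
have E := nbhs_singleton near_t.
have ct : {for t, continuous (signed_weight k x)}.
  have : (k u * (-1) ^+ i) @[u --> t] --> signed_weight k x t.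
    by rewrite E; apply: cvgMl; have [ck _ _ _] := W; exact: ck.
  by apply: cvg_trans; apply: near_eq_cvg; near do apply/esym.
have := is_derive_affine_itail c' ((-1) ^+ r.-1 * 1) df r0 (fun=> ct).
rewrite /itail/= E kg ?(ltW t0)// mulr1.
rewrite [X in is_derive _ _ _ X -> _](_ : _ = (-1) ^+ r * (-1) ^+ i * g t)//.
by rewrite -{2}(prednK r0) exprS mulN1r -mulrA [g t * _]mulrC.
Unshelve. all: by end_near. Qed.

End Knots.
End PerfectSplines.

(** * The parameter at infinity and continuity of the amplitude *)

Section BoundaryParameter.
Context {R : realType}.

(** Immediate because the balls of the extended line are defined through [contract]. *)
Lemma continuous_contract : continuous (@contract R).
Proof.
move=> a; apply/cvgrPdist_lt => e e0; near=> b.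
have : ereal_ball a e b by near: b; exact: (nbhsx_ballx (a : \bar R)).
exact.
Unshelve. all: by end_near. Qed.

Lemma contract_ge0 (a : \bar R) : (0 <= a)%E -> 0 <= contract a <= 1.
Proof.
move=> a0; apply/andP; split; last by exact: le_trans (ler_norm _) (contract_le1 a).
by rewrite -(contract0 R) le_contract.
Qed.

(* The ratio at infinity is [v / (S - v)] for [n] even and [(S - v) / v] for [n] odd,
   where [S = f_+(oo) + f_-(oo)] and [v] is the argument of [offset]; [contract a] is
   [a / (1 + a)]. *)
Definition boundary_fraction n (a : \bar R) : R :=
  if odd n then 1 - contract a else contract a.

Lemma continuous_boundary_fraction n : continuous (boundary_fraction n).
Proof.
rewrite /boundary_fraction; case: (odd n) => a; last exact: continuous_contract.
by apply: cvgB; [exact: cvg_cst|exact: continuous_contract].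
Qed.

Lemma boundary_fraction_itv n a : J n a -> 0 < boundary_fraction n a <= 1.
Proof.
rewrite /J/= /boundary_fraction; case: (odd n).
  move=> /andP[a0 ay]; have /andP[c0 _] := contract_ge0 a0.
  have : contract a < contract (+oo%E : \bar R) by rewrite lt_contract.
  by move=> /= c1; rewrite subr_gt0 c1 lerBlDr lerDl.
move=> a0; have /andP[_ ->] := contract_ge0 (ltW a0).
by rewrite -(contract0 R) lt_contract a0.
Qed.

Lemma endpoint_ratio_offset (fp fm : R -> R) (tau : R) n (a : \bar R) :
  0 < lim_infty fp -> 0 < lim_infty fm -> 0 < tau -> J n a ->
  endpoint_ratio fp fm tau (tau * offset (lim_infty fp) (lim_infty fm) n
    ((lim_infty fp + lim_infty fm) * boundary_fraction n a)) a.
Proof.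
rewrite /endpoint_ratio /offset /boundary_fraction.
move: (lim_infty fp) (lim_infty fm) => Lp Lm Lp0 Lm0 tau0.
rewrite /J/=; case: a => [c| |]/=; last by case: (odd n).
- move=> Jc; have c0 : 0 <= c.
    by move: Jc; case: (odd n) => [/andP[]|]; rewrite ?lee_fin ?lte_fin// => /ltW.
  have d0 : 1 + c != 0 by rewrite gt_eqF// ltr_wpDr.
  have S0 : 0 < Lp + Lm by rewrite addr_gt0.
  rewrite ger0_norm//; set l := tau * (if odd n then _ else _).
  (* As a function of [c] the limit is the same for both parities; the parity only decides from
     which boundary it is measured. *)
  have El : l = tau * (Lp - (Lp + Lm) * (c / (1 + c))).
    by rewrite /l; case: (odd n) => //; congr (_ * _); field.
  have E : tau * Lm + l = tau * (Lp + Lm) / (1 + c) by rewrite El; field.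
  have E0 : tau * Lm + l != 0.
    by rewrite E mulf_neq0 ?invr_eq0 ?d0// mulf_neq0// gt_eqF.
  split=> //; rewrite E El; field.
  by rewrite d0 !gt_eqF.
- by case: (odd n) => [/andP[_]|_]; rewrite ?ltxx// mulr1 opprD addNKr mulrN.
Qed.

(* The two monotonicity properties give [|T v' - T v| <= T v * |v' - v| / v']. *)
Lemma continuous_of_scaled_monotone (T : R -> R) (S : R) :
  (forall v, 0 < v <= S -> 0 < T v) ->
  (forall v v', 0 < v -> v <= v' -> v' <= S -> T v' <= T v) ->
  (forall v v', 0 < v -> v <= v' -> v' <= S -> v * T v <= v' * T v') ->
  {within `]0, S], continuous T}.
Proof.
move=> T0 Tn Ts; apply/subspace_continuousP => v; rewrite /= in_itv/= => v0S.
have /andP[v0 vS] := v0S.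
have H v' : 0 < v' <= S -> `|T v - T v'| <= T v * (`|v' - v| / v').
  move=> v'0S; have /andP[v'0 v'S] := v'0S.
  rewrite mulrA ler_pdivlMr// -[X in _ * X](gtr0_norm v'0) -normrM.
  have [vv|vv] := leP v v'.
    have h1 := Tn _ _ v0 vv v'S; have h2 := Ts _ _ v0 vv v'S.
    rewrite [`|v' - v|]ger0_norm ?subr_ge0// ger0_norm; first by lra.
    by rewrite mulr_ge0 ?subr_ge0// ltW.
  have h1 := Tn _ _ v'0 (ltW vv) vS; have h2 := Ts _ _ v'0 (ltW vv) vS.
  rewrite [`|v' - v|]ltr0_norm ?subr_lt0// ler0_norm; first by lra.
  by rewrite mulr_le0_ge0 ?subr_le0// ltW.
have L : T v * (`|v' - v| / v') @[v' --> v] --> (0 : R).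
  rewrite [X in _ --> X](_ : _ = T v * (`|v - v| / v)); last by rewrite subrr normr0 mul0r mulr0.
  apply: cvgMr; apply: cvgM; last by apply: cvgV; [rewrite gt_eqF|exact: cvg_id].
  by apply: cvg_norm; apply: cvgB; [exact: cvg_id|exact: cvg_cst].
apply/cvgrPdist_lt => e e0; move/cvgrPdist_lt: L => /(_ _ e0) L.
rewrite near_withinE; near=> v' => /=; rewrite in_itv/= => v'0S.
apply: le_lt_trans (H _ v'0S) _; apply: le_lt_trans (ler_norm _) _.
by rewrite -[X in `|X|]opprK normrN -[- _]add0r; near: v'.
Unshelve. all: by end_near. Qed.

End BoundaryParameter.

(** * Assembly of the theorem *)

Lemma equioscillates_pos_oscillation (R : realType) r (k fp fm : R -> R) Lp Lm n v tau
    (x : 'I_n -> R) s :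
  equioscillates r k (extend0 fp) (extend0 fm) Lp Lm v tau x s ->
  pos_oscillation n.+1 (fun t => - (tau * fm t)) (fun t => tau * fp t)
    (fun t => tau * offset Lp Lm n v + spline r k x t).
Proof.
move=> [tau0 _ [s0 ss] Hs Hb]; split=> [t t0|].
  have := Hb true t t0; have := Hb false t t0.
  rewrite /tube !extend0E// expr0 expr1 mul1r mulN1r.
  by move=> h1 h2; apply/andP; split; lra.
exists (fun i => s i.-1); split=> [//|[//|i]|[//|i]] /=.
  by rewrite ltnS => im; exact: ss.
rewrite ltnS => im; have := Hs i im; rewrite -(signr_odd _ i) /tube !extend0E//.
by case: (odd i); rewrite /= ?expr0 ?expr1; lra.
Qed.

Lemma assumption2_extend0 (R : realType) (f : R -> R) : assumption2 f ->
  [/\ continuous (extend0 f), 0 < lim_infty f & forall t, lim_infty f <= extend0 f t].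
Proof.
move=> [cf fni f0 L0]; split=> //; first exact: extend0_continuous.
move=> t; have [_] := lim_infty_nonincreasing fni f0; apply.
by rewrite le_max lexx.
Qed.

Theorem theorem3 (R : realType) (r : nat) (g fp fm : R -> R)
    (hr : (1 <= r)%N) (hg : assumption1 r g)
    (hfp : assumption2 fp) (hfm : assumption2 fm) :
  exists tau : nat -> \bar R -> R,
    [/\ forall (n : nat) (a : \bar R), J n a -> 0 < tau n a,
        forall (n : nat) (a : \bar R), J n a ->
          exists G : R -> R,
            [/\ Gamma r n g G,
                perfect_spline r g n G,
                pos_oscillation n.+1 (fun t => - (tau n a * fm t))
                  (fun t => tau n a * fp t) G &
                exists2 l : R, G t @[t --> +oo] --> l &
                  endpoint_ratio fp fm (tau n a) l a],
        forall n : nat,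
          {within @J R n, continuous (tau n)} /\
          (forall a b : \bar R, J n a -> J n b -> (a <= b)%E ->
             if odd n then tau n a <= tau n b else tau n b <= tau n a) &
        forall (n : nat) (a b : \bar R), (1 <= n)%N ->
          J n a -> J n.-1 b -> (0 < a)%E -> (0 < b)%E ->
          tau n a <= tau n.-1 b].
Proof.
have W := assumption1_weight hg.
have [cfp Lp0 fpL] := assumption2_extend0 hfp.
have [cfm Lm0 fmL] := assumption2_extend0 hfm.
pose Lp := lim_infty fp; pose Lm := lim_infty fm; pose S := Lp + Lm.
have S0 : 0 < S by rewrite addr_gt0.
(* The monotonicity lemmas hold for any equioscillating splines, so an arbitrary choice of the
   amplitude suffices; 0 is a default outside the range of [v]. *)
have /choice[T HT] : forall p : nat * R, exists tau, 0 < p.2 <= S -> exists (x : 'I_p.1 -> R) s,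
    equioscillates r (extend0 g) (extend0 fp) (extend0 fm) Lp Lm p.2 tau x s.
  move=> [n v].
  have [v0S|nv] := pselect (0 < v <= S); last by exists 0.
  have [tau [x [s H]]] := equioscillation_exists W hr cfp cfm fpL fmL n v0S.
  by exists tau => _; exists x, s.
have T0 n v : 0 < v <= S -> 0 < T (n, v) by move=> /(HT (n, v))[x [s []]].
have Tn n v v' : 0 < v -> v <= v' -> v' <= S -> T (n, v') <= T (n, v).
  move=> v0 vv vS.
  have [|x [s H]] := HT (n, v); first by rewrite v0 (le_trans vv).
  have [|x' [s' H']] := HT (n, v'); first by rewrite (lt_le_trans v0).
  exact: (equioscillation_nonincreasing W hr Lp0 Lm0 fpL fmL v0 vv H H').
have Ts n v v' : 0 < v -> v <= v' -> v' <= S -> v * T (n, v) <= v' * T (n, v').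
  move=> v0; rewrite le_eqVlt => /predU1P[->//|vv] vS.
  have [|x [s H]] := HT (n, v); first by rewrite v0 (le_trans (ltW vv)).
  have [|x' [s' H']] := HT (n, v'); first by rewrite (lt_trans v0).
  exact: (equioscillation_scaled_nondecreasing W fpL fmL v0 vv vS H H').
pose V n (a : \bar R) := S * boundary_fraction n a.
have VJ n a : J n a -> 0 < V n a <= S.
  by move=> /boundary_fraction_itv/andP[b0 b1]; rewrite mulr_gt0// ger_pMr.
exists (fun n a => T (n, V n a)); split.
- by move=> n a /VJ; exact: T0.
- move=> n a Ja; have [x [s H]] := HT (n, V n a) (VJ _ _ Ja).
  pose l := T (n, V n a) * offset Lp Lm n (V n a).
  have pG : perfect_spline r g n (fun t => l + spline r (extend0 g) x t).
    have [_ [x01 xinj] _ _ _] := H.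
    by apply: perfect_spline_shift => // t; exact: extend0E.
  exists (fun t => l + spline r (extend0 g) x t); split => //.
  + by exists n.
  + exact: equioscillates_pos_oscillation H.
  + exists l; last by apply: endpoint_ratio_offset => //; exact/T0/VJ.
    rewrite -[X in _ --> X]addr0; apply: cvgD; first exact: cvg_cst.
    exact: spline_cvg_at_oo.
- move=> n; split.
    have /subspace_continuousP cT := continuous_of_scaled_monotone (@T0 n) (@Tn n) (@Ts n).
    apply/subspace_continuousP => a Ja.
    have cV : V n b @[b --> within (J n) (nbhs a)] --> within `]0, S] (nbhs (V n a)).
      have cV : V n b @[b --> a] --> V n a.
        by apply: cvgMr; exact: continuous_boundary_fraction.
      move=> U HU; apply: (@filterS _ (nbhs a) _ _ _ _ (cV _ HU)) => b /= HVb Jb.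
      by apply: HVb; rewrite in_itv/=; exact: VJ.
    have VI : `]0, S]%classic (V n a) by rewrite /= in_itv/=; exact: VJ.
    exact: cvg_comp cV (cT _ VI).
  move=> a b Ja Jb ab; have /andP[a0 aS] := VJ _ _ Ja; have /andP[b0 bS] := VJ _ _ Jb.
  have := ab; rewrite -le_contract => cab.
  (* The amplitude decreases in [v], and [boundary_fraction] preserves the order for even [n] and
     reverses it for odd [n]. *)
  by move: a0 aS b0 bS; rewrite /V/boundary_fraction; case: (odd n) => a0 aS b0 bS;
    apply: Tn => //; rewrite ler_pM2l// lerD2l lerN2.
- move=> [//|n] a b _ Ja Jb _ _.
  have [x [s H]] := HT _ (VJ _ _ Ja : 0 < (n.+1, V n.+1 a).2 <= S).
  have [x' [s' H']] := HT _ (VJ _ _ Jb : 0 < (n, V n b).2 <= S).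
  exact: (equioscillation_adjacent W hr Lp0 Lm0 fpL fmL H H').
Qed.
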